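(* Let $Q$ be a quiver and $\mathbf d\in\mathbb Z_{\ge0}^{Q_0}$ a dimension vector. Let $F$ be a local field of characteristic zero with valuation ring $\mathcal O$ and residue field $\mathbb F_q$. For $s\in\mathbb C$ with $\mathrm{Re}(s)>0$, $$Z_{\mu_{Q,\mathbf d}}(s)=1-\sum_{i=0}^{r}\frac{q^{-i}(1-q^{-s})}{1-q^{-(s+i)}}\cdot\int_{R(Q,\mathbf d)(\mathcal O)}\left(\left(\frac{\Vert\Delta_i(x)\Vert}{\Vert\Delta_{i-1}(x)\Vert}\right)^{s+i}-\left(\frac{\Vert\Delta_{i+1}(x)\Vert}{\Vert\Delta_i(x)\Vert}\right)^{s+i}\right)\frac{dx}{\Vert\Delta_i(x)\Vert},$$ where $\Delta_i(x)$ is the vector of all $i\times i$ minors of the matrix of the linear map $\mu_{Q,\mathbf d}(x,\bullet)$, $r=\max_{x\in R(Q,\mathbf d)(\mathcal O)}\mathrm{rk}(\mu_{Q,\mathbf d}(x,\bullet))$, and by convention $\Vert\Delta_{-1}(x)\Vert=\Vert\Delta_0(x)\Vert=1$ and $\Vert\Delta_{r+1}(x)\Vert=0$.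
   Context: A quiver $Q=(Q_0,Q_1,s,t)$ has finite vertex set $Q_0$ and arrow set $Q_1$. $R(Q,\mathbf d)=\prod_{a\in Q_1}\mathrm{Mat}_{d_{t(a)}\times d_{s(a)}}$, $R(Q,\mathbf d)^\vee\simeq\prod_{a}\mathrm{Mat}_{d_{s(a)}\times d_{t(a)}}$ (via the trace pairing), $\mathfrak{gl}_{\mathbf d}=\prod_{i\in Q_0}\mathrm{Mat}_{d_i\times d_i}$, and the moment map $\mu_{Q,\mathbf d}:R(Q,\mathbf d)\times R(Q,\mathbf d)^\vee\to\mathfrak{gl}_{\mathbf d}$ is $$\mu_{Q,\mathbf d}(x,y)=\Big(\sum_{t(a)=i}x_ay_a-\sum_{s(a)=i}y_ax_a\Big)_{i\in Q_0}.$$ For fixed $x$, $\mu_{Q,\mathbf d}(x,\bullet):R(Q,\mathbf d)^\vee\to\mathfrak{gl}_{\mathbf d}$ is linear, and its matrix is taken in the standard bases of matrix entries. $F$ carries the absolute value with $|\varpi|=q^{-1}$ for a uniformiser $\varpi$; $\Vert v\Vert=\max_i|v_i|$ on $F^m$; $dx$ is the Haar measure on $F^m$ giving $\mathcal O^m$ volume 1. For a tuple $f$ of polynomials in $m$ variables over $\mathcal O$, Igusa's local zeta function is $Z_f(s)=\int_{\mathcal O^m}\Vert f(x)\Vert^s\,dx$. So $Z_{\mu_{Q,\mathbf d}}(s)=\int\Vert\mu_{Q,\mathbf d}(x,y)\Vert^s\,dx\,dy$ over $R(Q,\mathbf d)(\mathcal O)\times R(Q,\mathbf d)^\vee(\mathcal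 O)$. The integrands on the right-hand side are defined for almost every $x$. *)

(* Defs.v *)
From HB Require Import structures.
From mathcomp Require Import all_boot all_order all_algebra.
From mathcomp Require Import all_classical all_reals all_analysis.
From mathcomp Require Import complex.

Set Implicit Arguments.
Unset Strict Implicit.
Unset Printing Implicit Defensive.

Import Order.TTheory GRing.Theory Num.Theory.

Local Open Scope classical_set_scope.
Local Open Scope ring_scope.
Local Open Scope complex_scope.

(* Lets products of additive groups with a topology be seen as such. *)
HB.saturate prod.

(* A non-archimedean local field: a field that is complete for a discrete
   ultrametric absolute value with finite residue field.  The residue field is
   the set of cosets x + m of the maximal ideal m = {|x| < 1} in the valuation
   ring {|x| <= 1}; [labs] is normalised by |w| = q^-1, where w generates m
   and q is the number of these cosets. *)
HB.mixin Record isLocalField (R : realType) F & GRing.Field F := {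
  labs : F -> R ;
  residue_card : nat ;
  labs_ge0 : forall x, 0 <= labs x ;
  labs_eq0 : forall x, labs x = 0 <-> x = 0 ;
  labsM : forall x y, labs (x * y) = labs x * labs y ;
  labsD : forall x y, labs (x + y) <= Num.max (labs x) (labs y) ;
  labs_complete : forall u : nat -> F,
    (forall e, 0 < e -> exists N, forall m n,
       (N <= m)%N -> (N <= n)%N -> labs (u m - u n) < e) ->
    exists l, forall e, 0 < e -> exists N, forall n,
       (N <= n)%N -> labs (u n - l) < e ;
  card_residue :
    ([set [set y | labs (y - x) < 1] | x in [set x | labs x <= 1]]
      #= `I_residue_card)%card ;
  labs_uniformizer : exists w,
    labs w = residue_card%:R^-1 /\
    forall x, labs x < 1 <-> exists2 u, labs u <= 1 & x = w * u
}.

#[short(type="localFieldType")]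
HB.structure Definition LocalField (R : realType) :=
  {F of GRing.Field F & isLocalField R F}.

Arguments residue_card {R} s.

Section LocalFieldTopology.
Variables (R : realType) (F : localFieldType R).
Implicit Types x y z : F.

Let dist x y : R := labs (x - y).

Let labs1 : labs (1 : F) = 1.
Proof.
have n0 : labs (1 : F) != 0 by apply/eqP => /labs_eq0/eqP; rewrite oner_eq0.
by apply: (mulfI n0); rewrite -labsM !mulr1.
Qed.

Let labsN x : labs (- x) = labs x.
Proof.
have h : labs (-1 : F) = 1.
  have /eqP := labsM (-1 : F) (-1); rewrite mulrNN mulr1 labs1 eq_sym -expr2.
  by rewrite sqrf_eq1 => /orP[/eqP//|/eqP e]; have := labs_ge0 (-1 : F); rewrite e oppr_ge0 ler10.
by rewrite -mulN1r labsM h mul1r.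
Qed.

Let distxx x : dist x x = 0.
Proof. by rewrite /dist subrr; apply/labs_eq0. Qed.

Let dist_eq0 x y : dist x y = 0 -> x = y.
Proof. by move=> /labs_eq0/eqP; rewrite subr_eq0 => /eqP. Qed.

Let distC x y : dist x y = dist y x.
Proof. by rewrite /dist -opprB labsN. Qed.

Let dist_triangle y x z : dist x z <= dist x y + dist y z.
Proof.
have -> : dist x z = labs ((x - y) + (y - z)) by rewrite /dist addrA subrK.
apply: (le_trans (labsD _ _)); rewrite ge_max.
by rewrite lerDl lerDr !labs_ge0.
Qed.

HB.instance Definition _ := @isMetric.Build R F
  dist distxx dist_eq0 distC dist_triangle.
HB.instance Definition _ := isPointed.Build F 0.
End LocalFieldTopology.

Definition mxfam (F : Type) (I : finType) (m n : I -> nat) : Type :=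
  forall i : I, 'M[F]_(m i, n i).

Section MxfamTheory.
Variables (R : realType) (F : localFieldType R) (I : finType) (m n : I -> nat).

HB.instance Definition _ := PseudoMetric.copy (mxfam F m n)
  (prod_topology (fun i => 'M[F]_(m i, n i))).

Implicit Types f g h : mxfam F m n.

Let zero : mxfam F m n := fun=> 0.
Let opp f : mxfam F m n := fun i => - f i.
Let add f g : mxfam F m n := fun i => f i + g i.

Let addA : associative add.
Proof. by move=> f g h; apply: functional_extensionality_dep => i; exact: addrA. Qed.

Let addC : commutative add.
Proof. by move=> f g; apply: functional_extensionality_dep => i; exact: addrC. Qed.

Let add0 : left_id zero add.
Proof. by move=> f; apply: functional_extensionality_dep => i; exact: add0r. Qed.

Let addN : left_inverse zero opp add.
Proof. by move=> f; apply: functional_extensionality_dep => i; exact: addNr. Qed.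

HB.instance Definition _ := GRing.isZmodule.Build (mxfam F m n) addA addC add0 addN.
HB.instance Definition _ := isPointed.Build (mxfam F m n) 0.
End MxfamTheory.

Section Mxfam.
Variables (R : realType) (F : localFieldType R) (I : finType) (m n : I -> nat).

Definition mxidx : finType := {i : I & ('I_(m i) * 'I_(n i))%type}.

Definition mxentry (f : mxfam F m n) (u : mxidx) : F :=
  f (tag u) (tagged u).1 (tagged u).2.

(* The standard basis vector with a 1 at the entry u and 0 elsewhere. *)
Definition mxfam_delta (u : mxidx) : mxfam F m n := fun i =>
  \matrix_(k, l) (Tagged (fun j => ('I_(m j) * 'I_(n j))%type) (k, l) == u)%:R.

Definition mxfam_integral : set (mxfam F m n) :=
  [set f | forall u, labs (mxentry f u) <= 1].
End Mxfam.

Definition vnorm (R : realType) (F : localFieldType R) (J : finType)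
    (v : J -> F) : R :=
  \big[Num.max/0]_(j : J) labs (v j).

Section Minors.
Variables (R : realType) (F : localFieldType R) (m n : nat).

(* Strictly increasing maps select the k rows (columns) of a k x k minor. *)
Definition incr_map (k p : nat) : finType :=
  {f : {ffun 'I_k -> 'I_p} | [forall a : 'I_k, forall b : 'I_k, (a < b)%N ==> (f a < f b)%N]}.

Definition minors (A : 'M[F]_(m, n)) (k : nat)
    (fg : incr_map k m * incr_map k n) : F :=
  \det (mxsub (val fg.1) (val fg.2) A).

(* ||Delta_k|| with the conventions ||Delta_(-1)|| = ||Delta_0|| = 1 and
   ||Delta_(r+1)|| = 0. *)
Definition minors_norm (r : nat) (A : 'M[F]_(m, n)) (k : int) : R :=
  if k <= 0 then 1
  else if k == r.+1%:Z then 0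
  else vnorm (@minors A `|k|%N).
End Minors.

Record quiver := Quiver {
  vertex : finType ;
  arrow : finType ;
  src : arrow -> vertex ;
  tgt : arrow -> vertex
}.

Section Moment.
Variables (R : realType) (F : localFieldType R).
Variables (Q : quiver) (d : vertex Q -> nat).

Definition rep : Type :=
  mxfam F (fun a : arrow Q => d (tgt a)) (fun a => d (src a)).

Definition corep : Type :=
  mxfam F (fun a : arrow Q => d (src a)) (fun a => d (tgt a)).

(* In each sum the dimension d (tgt a), resp. d (src a), equals d i, and
   [conform_mx] transports the summand along this equality. *)
Definition moment (x : rep) (y : corep) : mxfam F d d := fun i =>
  \sum_(a : arrow Q | tgt a == i) conform_mx (0 : 'M[F]_(d i)) (x a *m y a) -
  \sum_(a : arrow Q | src a == i) conform_mx (0 : 'M[F]_(d i)) (y a *m x a).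

Definition moment_mx (x : rep) :
    'M[F]_(#|mxidx d d|,
           #|mxidx (fun a : arrow Q => d (src a)) (fun a => d (tgt a))|) :=
  \matrix_(u, v) mxentry (moment x (mxfam_delta F (enum_val v))) (enum_val u).

Definition rep_integral : set rep := @mxfam_integral R F _ _ _.
Definition corep_integral : set corep := @mxfam_integral R F _ _ _.

(* max of rk (moment x _) over integral x; the bound on k is the dimension of
   the source of moment x, so that no rank is left out. *)
Definition moment_rank : nat :=
  \max_(k < #|mxidx (fun a : arrow Q => d (src a)) (fun a => d (tgt a))|.+1 |
         `[< exists2 x, rep_integral x & \rank (moment_mx x) = k >]) k.
End Moment.

Arguments rep {R} F {Q} d.
Arguments corep {R} F {Q} d.
Arguments moment {R F Q d} x y.
Arguments moment_mx {R F Q d} x.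
Arguments rep_integral {R} F {Q} d.
Arguments corep_integral {R} F {Q} d.
Arguments moment_rank {R} F {Q} d.

(* t ^ z for t >= 0, with 0 ^ z = 0 when Re z != 0. *)
Definition cpow (R : realType) (t : R) (z : R[i]) : R[i] :=
  (t `^ complex.Re z)%:C *
  (cos (complex.Im z * ln t) +i* sin (complex.Im z * ln t)).

Section ComplexIntegral.
Variables (disp : measure_display) (T : measurableType disp) (R : realType).
Variables (mu : {measure set T -> \bar R}) (D : set T) (f : T -> R[i]).

Definition cintegrable : Prop :=
  mu.-integrable D (fun x => (complex.Re (f x))%:E) /\
  mu.-integrable D (fun x => (complex.Im (f x))%:E).

Definition cintegral : R[i] :=
  Rintegral mu D (fun x => complex.Re (f x)) +i*
  Rintegral mu D (fun x => complex.Im (f x)).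
End ComplexIntegral.

Notation borel V := (g_sigma_algebraType (@open V)).

(* A Borel measure satisfying this is the Haar measure with mu O = 1: for V a
   finite-dimensional space over a local field and O its integral points, it
   is finite on compact sets and regular. *)
Definition normalized_haar (R : realType) (V : PreTopologicalZmodule.type)
    (O : set V) (mu : set V -> \bar R) : Prop :=
  (forall (v : V) (A : set V), <<s open >> A ->
     mu [set v + x | x in A] = mu A) /\
  mu O = 1%E.

(* Igusa's local zeta function of f, where O is the set of integral points. *)
Definition igusa_zeta (R : realType) (F : localFieldType R)
    (disp : measure_display) (T : measurableType disp)
    (mu : {measure set T -> \bar R}) (O : set T) (J : finType) (f : T -> J -> F)
    (s : R[i]) : R[i] :=
  cintegral mu O (fun x => cpow (vnorm (f x)) s).

(* Main.v *)
Require Import Defs.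
From HB Require Import structures.
From mathcomp Require Import all_boot all_order all_algebra.
From mathcomp Require Import all_classical all_reals all_analysis.
From mathcomp Require Import complex.
From mathcomp Require Import perm measurable_realfun ring.

(* Let A be the matrix of mu(x, .) for an integral point x.  By invertible
   integral row and column operations A becomes diagonal with entries of absolute
   values q^-a_0 >= q^-a_1 >= ...; hence ||Delta_i(x)|| = q^-(a_0 + ... + a_(i-1)),
   and the integral y with ||A y|| <= q^-k form a subgroup of index
   q^(sum_j max(k - a_j, 0)).  That subgroup depends only on x modulo w^k, w a
   uniformizer, so cutting the integral points into cosets shows that the measure
   of {||mu|| <= q^-k} is the integral over x of the inverse of this index; neither
   Fubini's theorem nor the uniqueness of Haar measures is needed.  Then
     X^s = 1 - (1 - q^-s) sum_k q^(-ks) [X <= q^-(k+1)]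
   for X = ||mu||, and summing the resulting series over each range
   a_(i-1) <= k < a_i, on which it is geometric, gives the i-th integrand.  The rank
   of A is almost everywhere maximal because the zero set of a non-zero minor is
   null, which also only uses the invariance under translations. *)

Set Implicit Arguments.
Unset Strict Implicit.
Unset Printing Implicit Defensive.

Import Order.TTheory GRing.Theory Num.Theory.
Import numFieldNormedType.Exports.

Local Open Scope classical_set_scope.
Local Open Scope ring_scope.
Local Open Scope complex_scope.

(** * Absolute values and balls in a local field *)

(** The measures [dx] and [dxdy] are given separately, each known only through invariance and one
    normalization. Counting links them: a disjoint union of n translates of H has n times the
    measure of H, and a congruence ball in x has the same index in R(O) as in its product with the
    integral y. No series is summed under an integral. Both sides are compared with the same numbers
    1 - (1 - q^-s) sum_(k < n) q^(-ks) P_(k+1), where P_k is the measure of {||mu|| <= q^-k}. With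
    rho = q^-Re(s), both pointwise errors are at most 2 rho^n / (1 - rho), uniformly, and domains of
    mass 1 pass this bound on to the integrals. The obstacle is the points of smaller rank, where
    some ||Delta_i|| vanish and denominators with them. As the inverse of 0 is 0, the integrands
    stay bounded by 2 there, so integrability holds over all of R(O), while the integrals are
    compared through an almost everywhere bound. Characteristic zero supplies the distinct scalars
    0, 1, 2, ... by which a zero set is translated to show that it is null. *)

Section LocalFieldValue.
Variables (R : realType) (F : localFieldType R).
Implicit Types x y z : F.

Lemma labs0 : labs (0 : F) = 0.
Proof. exact/labs_eq0. Qed.

Lemma labs_neq0 x : (labs x != 0) = (x != 0).
Proof.
by congr negb; apply/eqP/eqP => [/labs_eq0 //|->]; rewrite labs0.
Qed.

Lemma labs_gt0 x : (0 < labs x) = (x != 0).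
Proof. by rewrite lt_def labs_neq0 labs_ge0 andbT. Qed.

Lemma labs1 : labs (1 : F) = 1.
Proof.
have n0 : labs (1 : F) != 0 by rewrite labs_neq0 oner_eq0.
by apply: (mulfI n0); rewrite -labsM !mulr1.
Qed.

Lemma labsN x : labs (- x) = labs x.
Proof.
have h : labs (-1 : F) = 1.
  have /eqP := labsM (-1 : F) (-1).
  rewrite mulrNN mulr1 labs1 eq_sym -expr2 sqrf_eq1 => /orP[/eqP//|/eqP e].
  by have := labs_ge0 (-1 : F); rewrite e oppr_ge0 ler10.
by rewrite -mulN1r labsM h mul1r.
Qed.

Lemma labsB_le x y (t : R) : labs x <= t -> labs y <= t -> labs (x - y) <= t.
Proof.
by move=> hx hy; apply: le_trans (labsD _ _) _; rewrite ge_max labsN hx hy.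
Qed.

Lemma labsD_le x y (t : R) : labs x <= t -> labs y <= t -> labs (x + y) <= t.
Proof. by move=> hx hy; apply: le_trans (labsD _ _) _; rewrite ge_max hx hy. Qed.

Lemma labsD_lt x y (t : R) : labs x < t -> labs y < t -> labs (x + y) < t.
Proof. by move=> hx hy; apply: le_lt_trans (labsD _ _) _; rewrite gt_max hx hy. Qed.

Lemma labs_distC x y : labs (x - y) = labs (y - x).
Proof. by rewrite -labsN opprB. Qed.

Lemma labsV x : labs x^-1 = (labs x)^-1.
Proof.
have [->|x0] := eqVneq x 0; first by rewrite invr0 labs0 invr0.
have l0 : labs x != 0 by rewrite labs_neq0.
by apply: (mulfI l0); rewrite -labsM !divff // labs1.
Qed.

Lemma labsX x n : labs (x ^+ n) = labs x ^+ n.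
Proof. by elim: n => [|n IH]; rewrite ?expr0 ?labs1 // !exprS labsM IH. Qed.

Lemma labs_sum_le (J : Type) (s : seq J) (P : pred J) (f : J -> F) (t : R) :
  0 <= t -> (forall j, P j -> labs (f j) <= t) ->
  labs (\sum_(j <- s | P j) f j) <= t.
Proof.
move=> t0 h; elim/big_ind: _ => //; [by rewrite labs0|by move=> *; apply: labsD_le].
Qed.

Lemma labs_prod (J : Type) (s : seq J) (P : pred J) (f : J -> F) :
  labs (\prod_(j <- s | P j) f j) = \prod_(j <- s | P j) labs (f j).
Proof. exact: (big_morph (@labs R F) labsM labs1). Qed.

Lemma labs_sign (b : nat) : labs ((-1) ^+ b : F) = 1.
Proof. by rewrite labsX labsN labs1 expr1n. Qed.

Lemma labs_bool (b : bool) : labs (b%:R : F) <= 1.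
Proof. by case: b; rewrite ?labs1 ?labs0 ?ler01. Qed.

Lemma labs_mulB_le x x' y y' (t : R) : labs x <= 1 -> labs y' <= 1 ->
  labs (x - x') <= t -> labs (y - y') <= t -> labs (x * y - x' * y') <= t.
Proof.
move=> hx hy' h1 h2.
have -> : x * y - x' * y' = x * (y - y') + (x - x') * y' by ring.
apply: labsD_le; rewrite labsM.
  by apply: le_trans (ler_piMl (labs_ge0 _) hx) h2.
by apply: le_trans (ler_piMr (labs_ge0 _) hy') h1.
Qed.

Local Notation q := ((residue_card F)%:R : R).
Local Notation p := (q^-1).

(** The bijection behind [card_residue] reaches only cosets; a representative chosen in each gives
    the digits from which representatives modulo powers of the uniformizer are built. *)
Definition residue_rep : {e : 'I_(residue_card F) -> F |
  (forall i, labs (e i) <= 1) /\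
  forall x, labs x <= 1 -> exists i, labs (x - e i) < 1 /\
     forall j, labs (x - e j) < 1 -> j = i}.
Proof.
apply: cid; have /card_esym/pcard_eqP/unsquash f := card_residue (s := F).
have cl (i : 'I_(residue_card F)) : exists x, labs x <= 1 /\
     f i = [set y | labs (y - x) < 1].
  have [x hx e] : [set [set y : F | labs (y - x) < 1] | x in [set x | labs x <= 1]]
     (f i) by apply: funS; rewrite /= ltn_ord.
  by exists x.
have [e he] := choice cl; exists e; split=> [i|x hx]; first by case: (he i).
have self y : labs (y - y) < 1 by rewrite subrr labs0 ltr01.
have [i /= hi fi] : (f @` `I_(residue_card F)) [set y : F | labs (y - x) < 1].
  by apply: surj; exists x.
exists (Ordinal hi); have [e1 ei] := he (Ordinal hi); split.
  by have : [set y | labs (y - x) < 1] x by [exact: self]; rewrite -fi [X in X x]ei.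
move=> j xj; have [ej1 ej] := he j; apply: val_inj => /=.
have -> : i = Ordinal hi by [].
apply: (inj (f := f)); rewrite ?inE /= ?ltn_ord //.
(* The class of [e j] equals the class of x because it contains x. *)
rewrite ej ei -ei /= fi; apply/seteqP; split=> y /= h.
  by rewrite -(subrK (e j) y) -addrA; apply: labsD_lt => //; rewrite labs_distC.
by rewrite -(subrK x y) -addrA; apply: labsD_lt.
Qed.

Definition uniformizer : F := sval (cid (labs_uniformizer (s := F))).
Local Notation w := uniformizer.

Lemma labs_uniformizerE : labs w = p.
Proof. by rewrite /w; case: cid => ? []. Qed.

Lemma uniformizerP x : labs x < 1 <-> exists2 u, labs u <= 1 & x = w * u.
Proof. by rewrite /w; case: cid => ? []. Qed.

(** The classes of 0 and 1 differ, since otherwise |1| < 1. *)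
Lemma residue_card_gt1 : (1 < residue_card F)%N.
Proof.
have [e [e1 he]] := residue_rep.
have [|i [hi _]] := he 0; first by rewrite labs0 ler01.
have [|j [hj _]] := he 1; first by rewrite labs1.
have : i != j.
  apply/eqP => ij; subst j; have := labsD_lt hj (_ : labs (- (0 - e i)) < 1).
  by rewrite labsN opprB => /(_ hi); rewrite subr0 subrK labs1 ltxx.
case: (residue_card F) i j {e e1 he hi hj} => [[//]|[|//]] i j.
by rewrite !ord1 eqxx.
Qed.

Lemma q_gt1 : 1 < q. Proof. by rewrite ltr1n residue_card_gt1. Qed.
Lemma q_gt0 : 0 < q. Proof. exact: lt_trans ltr01 q_gt1. Qed.
Lemma p_gt0 : 0 < p. Proof. by rewrite invr_gt0 q_gt0. Qed.
Lemma p_lt1 : p < 1. Proof. by rewrite invf_lt1 ?q_gt1 ?q_gt0. Qed.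
Lemma p_neq0 : p != 0. Proof. by rewrite gt_eqF ?p_gt0. Qed.
Lemma pX_gt0 k : 0 < p ^+ k. Proof. by rewrite exprn_gt0 ?p_gt0. Qed.
Lemma pX_ge0 k : 0 <= p ^+ k. Proof. exact/ltW/pX_gt0. Qed.
Lemma pX_le1 k : p ^+ k <= 1.
Proof. by rewrite exprn_ile1 ?ltW ?p_gt0 ?p_lt1. Qed.

Lemma ler_pX k l : (p ^+ k <= p ^+ l) = (l <= k)%N.
Proof. by rewrite ler_iXn2l ?p_gt0 ?p_lt1. Qed.
Lemma pX_small (e : R) : 0 < e -> exists k, p ^+ k < e.
Proof.
move=> e0; have /cvgrPdist_lt/(_ _ e0)[N _ h] : (fun k => p ^+ k) @ \oo --> (0 : R).
  by apply: cvg_expr; rewrite ger0_norm ?p_lt1 // ltW ?p_gt0.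
exists N; have := h N (leqnn N); rewrite sub0r normrN ger0_norm //; exact: pX_ge0.
Qed.

(** An element of absolute value below 1 is divisible by the uniformizer; the induction is on an n
    with [p ^+ n < labs x], which bounds the number of divisions. *)
Lemma labs_level x : labs x <= 1 -> x != 0 -> exists k, labs x = p ^+ k.
Proof.
move=> x1 x0; have /pX_small[n] : 0 < labs x by rewrite labs_gt0.
elim: n x x1 x0 => [|n IH] x x1 x0; first by rewrite expr0 ltNge x1.
move: x1; rewrite le_eqVlt => /orP[/eqP ->|x1 hn]; first by exists 0; rewrite expr0.
have [u hu xu] := (uniformizerP x).1 x1; move: x0 hn.
rewrite xu mulf_eq0 negb_or labsM labs_uniformizerE exprS => /andP[_ u0].
rewrite ltr_pM2l ?p_gt0 // => /(IH u hu u0)[k ->].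
by exists k.+1; rewrite exprS.
Qed.

End LocalFieldValue.
Arguments uniformizer {R} F.

(** * Systems of representatives modulo congruence subgroups *)

Section Transversal.

(** For a subgroup H of L this says that n is the index of H, with representatives [e]. It is
    phrased through differences, so that H can stay a bare set. *)
Definition transversal (V : zmodType) (L H : set V) (n : nat) (e : 'I_n -> V) :=
  (forall t, L (e t)) /\
  forall x, L x -> exists t, H (x - e t) /\ forall t', H (x - e t') -> t' = t.

Lemma transversal_fintype (V : zmodType) (L H : set V) (T : finType) (e : T -> V) :
  (forall t, L (e t)) ->
  (forall x, L x -> exists t, H (x - e t) /\ forall t', H (x - e t') -> t' = t) ->
  exists e' : 'I_#|T| -> V, transversal L H e'.
Proof.
move=> eL eH; exists (fun t => e (enum_val t)); split=> // x /eH[t [xt tu]].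
exists (enum_rank t); rewrite enum_rankK; split=> // t' /tu <-.
by rewrite enum_valK.
Qed.

(** Serves to pass from columns to families of matrices, by their entries and, for the fibers, by
    their entries after a change of basis in GL(O). *)
Lemma transversal_transfer (V V' : zmodType) (L H : set V) (L' H' : set V') n
    (e : 'I_n -> V) (phi : V -> V') (psi : V' -> V) :
  (forall x, L x -> L' (phi x)) -> (forall y, L' y -> L (psi y)) ->
  {morph psi : x y / x - y} -> cancel phi psi ->
  (forall y, H' y <-> H (psi y)) ->
  transversal L H e -> transversal L' H' (phi \o e).
Proof.
move=> LL' L'L psiB phiK HH' [eL eH]; split=> [t|y /L'L/eH[t [yt tu]]].
  exact/LL'/eL.
exists t; split=> [|t' /HH'] /=; first by apply/HH'; rewrite psiB phiK.
by rewrite psiB phiK; exact: tu.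
Qed.

End Transversal.

Section LocalFieldTransversal.
Variables (R : realType) (F : localFieldType R).
Local Notation q := ((residue_card F)%:R : R).
Local Notation p := (q^-1).
Local Notation w := (uniformizer F).

(** Digit expansion: a representative modulo [w ^+ k.+1] is a residue digit plus w times a
    representative modulo [w ^+ k], and x modulo w forces the digit. *)
Lemma transversal_pX (k : nat) : exists e : 'I_(residue_card F ^ k) -> F,
  transversal [set x : F | labs x <= 1] [set x : F | labs x <= p ^+ k] e.
Proof.
have [rho [rho1 rhoP]] := residue_rep F.
elim: k => [|k [e [e1 eP]]].
  exists (fun=> 0); split=> [t /=|x /= x1]; first by rewrite labs0 ler01.
  exists (Ordinal (ltn0Sn 0)); rewrite subr0 expr0; split=> // t' _.
  by apply/eqP; case: t' => [[]].
have [] := @transversal_fintype F [set x : F | labs x <= 1]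
  [set x : F | labs x <= p ^+ k.+1] ('I_(residue_card F) * 'I_(residue_card F ^ k))%type
  (fun t => rho t.1 + w * e t.2).
- move=> t; apply: labsD_le => //; rewrite labsM labs_uniformizerE.
  by rewrite mulr_ile1 ?labs_ge0 ?(ltW (p_gt0 _)) ?(ltW (p_lt1 _)) //; exact: e1.
- move=> x x1; have [i [xi iu]] := rhoP x x1.
  have [u u1 xu] := (uniformizerP _).1 xi.
  have [j [uj ju]] := eP u u1.
  have wle y : labs (w * y) <= p ^+ k.+1 <-> labs y <= p ^+ k.
    by rewrite labsM labs_uniformizerE exprS ler_pM2l ?p_gt0.
  exists (i, j) => /=; split.
    by rewrite opprD addrA xu -mulrBr; apply/wle.
  move=> [i' j'] /= h.
  have i'i : i' = i.
    apply: iu; have -> : x - rho i' = (x - (rho i' + w * e j')) + w * e j' by ring.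
    apply: labsD_lt.
      by apply: le_lt_trans h _; rewrite exprn_ilt1 ?(ltW (p_gt0 _)) ?p_lt1.
    by apply/uniformizerP; exists (e j') => //; exact: e1.
  move: h; rewrite i'i opprD addrA xu -mulrBr => /wle h.
  by rewrite (ju _ h).
- by rewrite card_prod !card_ord -expnS => e' he'; exists e'.
Qed.

(** The exponent varies with the coordinate because a fiber, in suitable coordinates, is a box with
    unequal sides. *)
Lemma transversal_col (m : nat) (k : 'I_m -> nat) :
  exists e : 'I_(residue_card F ^ (\sum_i k i)) -> 'cV[F]_m,
  transversal [set v : 'cV[F]_m | forall i, labs (v i 0) <= 1]
    [set v : 'cV[F]_m | forall i, labs (v i 0) <= p ^+ k i] e.
Proof.
pose e i := sval (cid (transversal_pX (k i))).
have eP i : transversal [set x : F | labs x <= 1] [set x : F | labs x <= p ^+ k i] (e i).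
  exact: svalP (cid (transversal_pX (k i))).
pose T : finType := {dffun forall i, 'I_(residue_card F ^ k i)}.
have [] := @transversal_fintype 'cV[F]_m [set v : 'cV[F]_m | forall i, labs (v i 0) <= 1]
    [set v : 'cV[F]_m | forall i, labs (v i 0) <= p ^+ k i] T
    (fun t : T => \col_i e i (t i)).
- by move=> t i; rewrite mxE; exact: (eP i).1.
- move=> v v1.
  pose t i := sval (cid ((eP i).2 (v i 0) (v1 i))).
  have tP i : labs (v i 0 - e i (t i)) <= p ^+ k i /\
      forall t', labs (v i 0 - e i t') <= p ^+ k i -> t' = t i.
    exact: svalP (cid ((eP i).2 (v i 0) (v1 i))).
  exists ([ffun i => t i] : T); split=> [i|t' h].
    by rewrite !mxE ffunE; exact: (tP i).1.
  apply/ffunP => i; rewrite ffunE; apply: (tP i).2.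
  by move: (h i); rewrite !mxE.
- have -> : #|T| = (residue_card F ^ (\sum_i k i))%N; last by move=> e' he'; exists e'.
  rewrite card_dep_ffun foldrE big_map big_enum /=.
  under eq_bigr do rewrite card_ord.
  by rewrite (big_morph (expn (residue_card F)) (expnD _) (expn0 _)).
Qed.

End LocalFieldTransversal.

(** * The congruence topology on families of matrices *)

Section MxfamOpen.
Variables (R : realType) (F : localFieldType R).
Local Notation p := ((residue_card F)%:R^-1 : R).

(** By the ultrametric inequality, a closed ball of positive radius contains the open ball of that
    radius around each of its points. *)
Lemma open_labs_ball (c : F) (t : R) : 0 < t -> open [set x : F | labs (x - c) <= t].
Proof.
move=> t0; rewrite openE => x /= xc; apply/nbhs_ballP; exists t => //= y.
rewrite ballEmdist /= => xy; rewrite -(subrK x y) -addrA.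
by apply: labsD_le xc; rewrite labs_distC ltW.
Qed.

Variables (I : finType) (m n : I -> nat).

Lemma continuous_mxentry (u : mxidx m n) :
  continuous (fun f : mxfam F m n => mxentry f u).
Proof.
case: u => i [k l] f A Af; rewrite /mxentry /=.
have cf := @proj_continuous I (fun i => 'M[F]_(m i, n i)) i f.
apply: (cf [set M : 'M[F]_(m i, n i) | A (M k l)]).
exists (fun a b => if (a == k) && (b == l) then A else setT) => [a b|M /=].
  by case: ifP => [/andP[/eqP-> /eqP->]//|_]; exact: filterT.
by move/(_ k l); rewrite !eqxx.
Qed.

(** Congruence modulo [w ^+ k]. Its classes are open, and other sets of families are shown to be
    open by containing such a class around each point. *)
Definition mxcong (k : nat) (f g : mxfam F m n) :=
  forall u, labs (mxentry g u - mxentry f u) <= p ^+ k.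

Lemma mxcong_refl k f : mxcong k f f.
Proof. by move=> u; rewrite subrr labs0 pX_ge0. Qed.

Lemma open_mxcong k f : open (mxcong k f).
Proof.
rewrite openE => g fg.
have : \forall h \near nbhs g, forall u, labs (mxentry h u - mxentry f u) <= p ^+ k.
  apply: filter_forall => u.
  have op : open [set x | labs (x - mxentry f u) <= p ^+ k].
    exact/open_labs_ball/pX_gt0.
  apply: (@continuous_mxentry u g [set x | labs (x - mxentry f u) <= p ^+ k]).
  by apply: open_nbhs_nbhs; split=> //=; exact: fg.
by [].
Qed.

Lemma open_mxfam (A : set (mxfam F m n)) :
  (forall f, A f -> exists k, mxcong k f `<=` A) -> open A.
Proof.
move=> h; rewrite openE => f /h[k] sub; apply: (filterS sub).
by apply: open_nbhs_nbhs; split; [exact: open_mxcong|exact: mxcong_refl].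
Qed.

Lemma mxentryD (f g : mxfam F m n) u : mxentry (f + g) u = mxentry f u + mxentry g u.
Proof. by rewrite /mxentry /= mxE. Qed.

Lemma mxentryN (f : mxfam F m n) u : mxentry (- f) u = - mxentry f u.
Proof. by rewrite /mxentry /= mxE. Qed.

Lemma mxentryB (f g : mxfam F m n) u : mxentry (f - g) u = mxentry f u - mxentry g u.
Proof. by rewrite mxentryD mxentryN. Qed.

Lemma mxentry0 u : mxentry (0 : mxfam F m n) u = 0.
Proof. by rewrite /mxentry /= mxE. Qed.

Lemma mxfamP (f g : mxfam F m n) : (forall u, mxentry f u = mxentry g u) -> f = g.
Proof.
move=> h; apply: functional_extensionality_dep => i; apply/matrixP => k l.
exact: (h (Tagged (fun j => ('I_(m j) * 'I_(n j))%type) (k, l))).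
Qed.

Definition mxfam_of (v : mxidx m n -> F) : mxfam F m n := fun i =>
  \matrix_(k, l) v (Tagged (fun j => ('I_(m j) * 'I_(n j))%type) (k, l)).

Lemma mxfam_ofE v u : mxentry (mxfam_of v) u = v u.
Proof. by case: u => i [k l]; rewrite /mxentry /= mxE. Qed.

Definition mxfam_of_col (v : 'cV[F]_#|mxidx m n|) : mxfam F m n :=
  mxfam_of (fun u => v (enum_rank u) 0).
Definition col_of_mxfam (f : mxfam F m n) : 'cV[F]_#|mxidx m n| :=
  \col_i mxentry f (enum_val i).

Lemma mxfam_of_colK : cancel mxfam_of_col col_of_mxfam.
Proof.
by move=> v; apply/colP => i; rewrite mxE mxfam_ofE enum_valK.
Qed.

Lemma col_of_mxfamB : {morph col_of_mxfam : f g / f - g}.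
Proof. by move=> f g; apply/colP => i; rewrite !mxE mxentryB. Qed.

End MxfamOpen.

(** * Volumes computed by counting cosets *)

Lemma measure_borel_ord (R : realType) (T : ptopologicalType)
    (mu : {measure set (borel T) -> \bar R}) n (A : 'I_n -> set T) :
  (forall i, <<s open >> (A i)) -> trivIset setT A ->
  mu (\bigcup_i A i) = (\sum_i mu (A i))%E.
Proof.
move=> mA tA; rewrite -measure_bigsetU_ord //; congr (mu _).
rewrite -bigcup_seq; congr bigcup; apply/seteqP; split=> i //= _.
exact: mem_index_enum.
Qed.

Section HaarIndex.
Variables (R : realType) (V : PreTopologicalZmodule.type) (O : set V).
Variable mu : set V -> \bar R.
Hypothesis muD : forall n (A : 'I_n -> set V),
  (forall i, <<s open >> (A i)) -> trivIset setT A ->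
  mu (\bigcup_i A i) = (\sum_i mu (A i))%E.
Hypothesis haar : normalized_haar O mu.

Lemma translate_preimage (v : V) (A : set V) :
  [set v + x | x in A] = [set x | A (x - v)].
Proof.
apply/seteqP; split=> [_ [x Ax <-]|x Ax]; first by rewrite /= addrC addKr.
by exists (x - v) => //; rewrite addrC subrK.
Qed.

Lemma haar_translate (v : V) (A : set V) : <<s open >> A ->
  mu [set x | A (x - v)] = mu A.
Proof. by move=> mA; rewrite -translate_preimage; apply: haar.1. Qed.

(** L is the disjoint union of the translates of H by the representatives, and these all have the
    measure of H. Openness of the translates makes the pieces measurable. *)
Lemma haar_transversal (L H : set V) n (e : 'I_n -> V) :
  transversal L H e ->
  (forall t x, H (x - e t) -> L x) ->
  (forall v, open [set x | H (x - v)]) ->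
  mu L = (n%:R%:E * mu H)%E.
Proof.
move=> [eL eH] HL oH.
have mH v : <<s open >> [set x | H (x - v)] by apply: sub_sigma_algebra; exact: oH.
have mH0 : <<s open >> H.
  by have := mH 0; congr <<s _ >>; apply/seteqP; split=> x /=; rewrite subr0.
have -> : L = \bigcup_t [set x | H (x - e t)].
  apply/seteqP; split=> [x /eH[t [xt _]]|x [k _]]; first by exists t.
  by move/HL.
rewrite muD //; last first.
  apply/trivIsetP => i j _ _ /eqP ij; apply/seteqP; split=> // x [xi xj].
  by have [t [_ u]] := eH _ (HL _ _ xi); apply: ij; rewrite (u _ xi) (u _ xj).
under eq_bigr do rewrite haar_translate //.
by rewrite sumr_const card_ord mule_natl.
Qed.

End HaarIndex.

(** * Elementary divisors and norms of minors *)

Section IntegralEquivalence.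
Variables (R : realType) (F : localFieldType R).

Definition integral_mx m n (A : 'M[F]_(m, n)) := forall i j, labs (A i j) <= 1.

Lemma integral_mx1 n : integral_mx (1%:M : 'M[F]_n).
Proof. by move=> i j; rewrite mxE; exact: labs_bool. Qed.

Lemma integral_tperm_mx n (i j : 'I_n) : integral_mx (tperm_mx i j : 'M[F]_n).
Proof. by move=> a b; rewrite !mxE; exact: labs_bool. Qed.

Lemma labs_mulmx_le m n k (A : 'M[F]_(m, n)) (B : 'M[F]_(n, k)) (t u : R) :
  0 <= t -> 0 <= u -> (forall i j, labs (A i j) <= t) -> (forall i j, labs (B i j) <= u) ->
  forall i j, labs ((A *m B) i j) <= t * u.
Proof.
move=> t0 u0 hA hB i j; rewrite mxE; apply: labs_sum_le; first exact: mulr_ge0.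
by move=> l _; rewrite labsM; apply: ler_pM; rewrite ?labs_ge0.
Qed.

Lemma integral_mulmx m n k (A : 'M[F]_(m, n)) (B : 'M[F]_(n, k)) :
  integral_mx A -> integral_mx B -> integral_mx (A *m B).
Proof.
by move=> hA hB i j; rewrite -[leRHS]mulr1; apply: labs_mulmx_le; rewrite ?ler01.
Qed.

Lemma integral_block_mx m1 m2 n1 n2 (A : 'M[F]_(m1, n1)) (B : 'M[F]_(m1, n2))
    (C : 'M[F]_(m2, n1)) (D : 'M[F]_(m2, n2)) :
  integral_mx A -> integral_mx B -> integral_mx C -> integral_mx D ->
  integral_mx (block_mx A B C D).
Proof.
move=> hA hB hC hD i j.
by case: (split_ordP i) => i' ->; case: (split_ordP j) => j' ->;
  rewrite ?(block_mxEul, block_mxEur, block_mxEdl, block_mxEdr).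
Qed.

Lemma integral_mx0 m n : integral_mx (0 : 'M[F]_(m, n)).
Proof. by move=> i j; rewrite mxE labs0. Qed.

(* The integral right inverses L' and U' place L and U in GL(O). *)
Definition integral_equiv m n (A B : 'M[F]_(m, n)) :=
  exists (L L' : 'M[F]_m) (U U' : 'M[F]_n),
    [/\ [/\ integral_mx L, integral_mx L', integral_mx U & integral_mx U'],
        L *m L' = 1%:M, U *m U' = 1%:M & B = L *m A *m U].

Lemma integral_equiv_refl m n (A : 'M[F]_(m, n)) : integral_equiv A A.
Proof.
exists 1%:M, 1%:M, 1%:M, 1%:M; rewrite !mulmx1 mul1mx.
by split=> //; split; exact: integral_mx1.
Qed.

Lemma integral_equiv_sym m n (A B : 'M[F]_(m, n)) :
  integral_equiv A B -> integral_equiv B A.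
Proof.
move=> [L [L' [U [U' [[iL iL' iU iU'] LL' UU' ->]]]]].
exists L', L, U', U; split=> //; [exact: mulmx1C|exact: mulmx1C|].
by rewrite !mulmxA (mulmx1C LL') mul1mx -mulmxA UU' mulmx1.
Qed.

Lemma integral_equiv_trans m n (A B C : 'M[F]_(m, n)) :
  integral_equiv A B -> integral_equiv B C -> integral_equiv A C.
Proof.
move=> [L [L' [U [U' [[iL iL' iU iU'] LL' UU' ->]]]]].
move=> [M [M' [V [V' [[iM iM' iV iV'] MM' VV' ->]]]]].
exists (M *m L), (L' *m M'), (U *m V), (V' *m U'); split.
- by split; exact: integral_mulmx.
- by rewrite mulmxA -(mulmxA M) LL' mulmx1.
- by rewrite mulmxA -(mulmxA U) VV' mulmx1.
- by rewrite !mulmxA.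
Qed.

Lemma integral_equiv_le m n (A B : 'M[F]_(m, n)) (t : R) : integral_equiv A B ->
  (forall i j, labs (A i j) <= t) -> forall i j, labs (B i j) <= t.
Proof.
move=> [L [L' [U [U' [[iL _ iU _] _ _ ->]]]]] hA i j.
(* The sign of t comes from an entry of A; if A has no entries, there are no i and j to consider. *)
have t0 : 0 <= t.
  case: m n A B L L' U U' iL iU hA i j => [|m] [|n] A B L L' U U' iL iU hA [i hi] [j hj] //.
  exact: le_trans (labs_ge0 _) (hA 0 0).
rewrite -[t]mulr1; apply: labs_mulmx_le; rewrite ?ler01 // => k l.
by rewrite -[t]mul1r; apply: labs_mulmx_le; rewrite ?ler01.
Qed.

Lemma integral_equiv_block m n (A B : 'M[F]_(m, n)) (a : F) :
  integral_equiv A B ->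
  integral_equiv (block_mx a%:M 0 0 A : 'M[F]_(1 + m, 1 + n)) (block_mx a%:M 0 0 B).
Proof.
move=> [L [L' [U [U' [[iL iL' iU iU'] LL' UU' ->]]]]].
exists (block_mx 1%:M 0 0 L), (block_mx 1%:M 0 0 L'),
  (block_mx 1%:M 0 0 U), (block_mx 1%:M 0 0 U'); split.
- by split; apply: integral_block_mx => //;
    do ?[exact: integral_mx1|exact: integral_mx0].
- by rewrite mulmx_block !mulmx0 !mul0mx !addr0 add0r mulmx1 LL' -scalar_mx_block.
- by rewrite mulmx_block !mulmx0 !mul0mx !addr0 add0r mulmx1 UU' -scalar_mx_block.
- by rewrite !mulmx_block !(mulmx0, mul0mx, addr0, add0r, mulmx1, mul1mx).
Qed.

(** The diagonal is a sequence on all of nat, so that minors and ranks can refer to its entries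
    without bound proofs. *)
Definition diag_rect m n (dd : nat -> F) : 'M[F]_(m, n) :=
  \matrix_(i, j) if i == j :> nat then dd i else 0.

(** Gaussian elimination with a pivot of largest absolute value: the multipliers that clear its row
    and column are integral, and the remaining entries do not exceed it, which gives the
    ordering. *)
Lemma smith_normal_form m n (A : 'M[F]_(m, n)) : exists dd : nat -> F,
  [/\ integral_equiv A (diag_rect m n dd),
      forall i, labs (dd i.+1) <= labs (dd i)
    & forall i, (minn m n <= i)%N -> dd i = 0].
Proof.
elim: m n A => [|m IH] n A.
  exists (fun=> 0); split=> //; have -> : A = diag_rect 0 n (fun=> 0).
    by apply/matrixP => -[].
  exact: integral_equiv_refl.
case: n A => [|n] A.
  exists (fun=> 0); split=> //; have -> : A = diag_rect m.+1 0 (fun=> 0).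
    by apply/matrixP => i -[].
  exact: integral_equiv_refl.
have [ij ijP] : exists ij : 'I_m.+1 * 'I_n.+1,
    forall kl : 'I_m.+1 * 'I_n.+1, labs (A kl.1 kl.2) <= labs (A ij.1 ij.2).
  pose f (kl : 'I_m.+1 * 'I_n.+1) := labs (A kl.1 kl.2).
  case: (@Order.TotalTheory.arg_maxP _ _ _ (ord0, ord0) xpredT f) => // ij _ h.
  by exists ij => kl; exact: h.
have [a0|a0] := eqVneq (A ij.1 ij.2) 0.
  exists (fun=> 0); split=> //; have -> : A = diag_rect m.+1 n.+1 (fun=> 0).
    apply/matrixP => i j; rewrite mxE if_same; apply/labs_eq0/eqP.
    by rewrite eq_le labs_ge0 andbT; have := ijP (i, j); rewrite a0 labs0.
  exact: integral_equiv_refl.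
pose A1 : 'M[F]_(1 + m, 1 + n) := tperm_mx 0 ij.1 *m A *m tperm_mx 0 ij.2.
have A1E i j : A1 i j = A (tperm 0 ij.1 i) (tperm 0 ij.2 j).
  by rewrite /A1 -xrowE -xcolE !mxE.
have eq1 : integral_equiv A A1.
  exists (tperm_mx 0 ij.1), (tperm_mx 0 ij.1), (tperm_mx 0 ij.2), (tperm_mx 0 ij.2).
  by split; [split; exact: integral_tperm_mx| | |]; rewrite // -perm_mxM tperm2 perm_mx1.
clearbody A1.
pose a := A ij.1 ij.2; pose r := ursubmx A1; pose c := dlsubmx A1.
have ulA1 : ulsubmx A1 = a%:M.
  apply/matrixP => i j; rewrite !ord1 !mxE A1E eqxx mulr1n /a.
  by congr (A _ _); rewrite (_ : lshift _ 0 = 0) ?tpermL //; exact: val_inj.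
have le1 i j : labs (a^-1 * A1 i j) <= 1.
  rewrite labsM labsV mulrC ler_pdivrMr ?labs_gt0 // mul1r A1E.
  exact: (ijP (_, _)).
(* The lower right block is the Schur complement of the pivot. *)
pose A2 : 'M[F]_(1 + m, 1 + n) := block_mx a%:M 0 0 (drsubmx A1 - a^-1 *: (c *m r)).
have eq2 : integral_equiv A1 A2.
  exists (block_mx 1%:M 0 (- (a^-1 *: c)) 1%:M), (block_mx 1%:M 0 (a^-1 *: c) 1%:M),
    (block_mx 1%:M (- (a^-1 *: r)) 0 1%:M), (block_mx 1%:M (a^-1 *: r) 0 1%:M); split.
  - split; apply: integral_block_mx; do ?[exact: integral_mx1|exact: integral_mx0];
      by move=> i j; rewrite !mxE ?labsN; exact: le1.
  - rewrite mulmx_block !mulmx0 !mul0mx !addr0 add0r !mulmx1 mul1mx addNr.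
    by rewrite -scalar_mx_block.
  - rewrite mulmx_block !mulmx0 !mul0mx !addr0 add0r !mulmx1 mul1mx subrr.
    by rewrite -scalar_mx_block.
  - rewrite -[A1]submxK ulA1 !mulmx_block !(mulmx0, mul0mx, addr0, add0r, mulmx1, mul1mx).
    rewrite /A2 -/r -/c; congr block_mx.
    + by rewrite mulmxN -scalemxAr mul_scalar_mx scalerA mulVf // scale1r addNr.
    + by rewrite mulNmx -scalemxAl mul_mx_scalar scalerA mulVf // scale1r addNr.
    + rewrite mulNmx -scalemxAl mul_mx_scalar scalerA mulVf // scale1r addNr.
      by rewrite mul0mx add0r mulNmx -scalemxAl addrC.
have [dd [eq3 dle dd0]] := IH _ (drsubmx A1 - a^-1 *: (c *m r)).
(* Each non-trivial [dd i] is an entry of a matrix equivalent to the Schur complement, whose entries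
   are differences of terms bounded by the pivot. *)
have dda i : labs (dd i) <= labs a.
  have [im|] := ltnP i (minn m n); last by move/dd0 ->; rewrite labs0 labs_ge0.
  move: im; rewrite leq_min => /andP[im jn].
  have -> : dd i = diag_rect m n dd (Ordinal im) (Ordinal jn) by rewrite mxE eqxx.
  apply: (integral_equiv_le eq3) => k l; rewrite !mxE; apply: labsB_le.
    by rewrite A1E; exact: (ijP (_, _)).
  rewrite mulr_sumr; apply: labs_sum_le => [|u _]; first exact: labs_ge0.
  rewrite mulrA labsM !mxE -[leRHS]mul1r; apply: ler_pM; rewrite ?labs_ge0 ?le1 //.
  by rewrite A1E; exact: (ijP (_, _)).
exists (fun i => if i is i'.+1 then dd i' else a); split; last 2 first.
- by case=> [|i]; [exact: dda|exact: dle].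
- by case=> [|i]; rewrite ?minnSS // ltnS; exact: dd0.
apply: integral_equiv_trans eq1 _; apply: integral_equiv_trans eq2 _.
have -> : diag_rect m.+1 n.+1 (fun i => if i is i'.+1 then dd i' else a) =
   block_mx a%:M 0 0 (diag_rect m n dd) :> 'M[F]_(1 + m, 1 + n).
  apply/matrixP => i j; case: (split_ordP i) => i' ->; case: (split_ordP j) => j' ->;
  rewrite ?(block_mxEul, block_mxEur, block_mxEdl, block_mxEdr) !mxE ?ord1 //=.
exact: integral_equiv_block.
Qed.

End IntegralEquivalence.

(** * Minors and rank under integral row and column operations *)

Section MinorsNorm.
Variables (R : realType) (F : localFieldType R).

Lemma vnorm_ge0 (J : finType) (v : J -> F) : 0 <= vnorm v.
Proof. by rewrite /vnorm; apply: bigmax_ge_id. Qed.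

Lemma le_vnorm (J : finType) (v : J -> F) j : labs (v j) <= vnorm v.
Proof. exact: (le_bigmax _ (fun j => labs (v j))). Qed.

Lemma vnorm_le (J : finType) (v : J -> F) (t : R) : 0 <= t ->
  reflect (forall j, labs (v j) <= t) (vnorm v <= t).
Proof.
move=> t0; apply: (iffP idP) => [vt j|vt]; first exact: le_trans (le_vnorm _ _) vt.
by apply: bigmax_le.
Qed.

Lemma vnorm_diff_le (J : finType) (v v' : J -> F) (t : R) :
  (forall j, labs (v j - v' j) <= t) -> vnorm v <= Num.max (vnorm v') t.
Proof.
move=> h; apply/vnorm_le => [|j]; first by rewrite le_max vnorm_ge0.
rewrite -(subrK (v' j) (v j)); apply: labsD_le; rewrite le_max.
  by rewrite h orbT.
by rewrite le_vnorm.
Qed.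

(** Cauchy-Binet before terms are collected. Keeping all maps [phi] is harmless for an ultrametric
    bound, in which repetitions and signs cost nothing. *)
Lemma det_mulmx_rowsub k N (P : 'M[F]_(k, N)) (X : 'M[F]_(N, k)) :
  \det (P *m X) =
  \sum_(phi : {ffun 'I_k -> 'I_N}) (\prod_a P a (phi a)) * \det (rowsub phi X).
Proof.
rewrite /determinant; under [RHS]eq_bigr do rewrite mulr_sumr.
rewrite exchange_big /=; apply: eq_bigr => s _.
under eq_bigr do rewrite mxE.
rewrite bigA_distr_bigA /= mulr_sumr; apply: eq_bigr => phi _.
rewrite big_split /= mulrCA; congr (_ * (_ * _)).
by apply: eq_bigr => a _; rewrite mxE.
Qed.

(** [g] lists the image of [f] in increasing order, and [s] sends a to the rank of [f a] in that
    list. *)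
Lemma injective_incr_perm k N (f : 'I_k -> 'I_N) : injective f ->
  exists (g : incr_map k N) (s : 'S_k), forall a, f a = val g (s a).
Proof.
move=> finj; pose A := imset f (mem (predT : pred 'I_k)).
have cA : #|A| = k by rewrite card_imset // card_ord.
have fA a : f a \in A by apply: imset_f.
pose g (a : 'I_k) : 'I_N := enum_val (cast_ord (esym cA) a).
have gincr (a b : 'I_k) : (a < b)%N -> (g a < g b)%N.
  move=> ab; rewrite /g /enum_val.
  set x0 := enum_default _; set y0 := enum_default _.
  (* The enumeration of A is increasing because it filters the enumeration of ['I_N]. *)
  have srt : sorted ltn [seq val i | i <- enum A].
    have -> : [seq val i | i <- enum A] = [seq j <- iota 0 N | j \in [seq val i | i <- enum A]].
      rewrite -[in RHS]val_enum_ord filter_map; congr map.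
      transitivity [seq x <- enum 'I_N | x \in A]; first by rewrite enumT.
      apply: eq_filter => i /=.
      by rewrite mem_map ?mem_enum //; exact: val_inj.
    by apply: sorted_filter; [exact: ltn_trans|exact: iota_ltn_sorted].
  have sz (c : 'I_k) : (c < size (enum A))%N by rewrite -cardE cA.
  have ntE x (c : 'I_k) : val (nth x (enum A) c) = nth 0 [seq val i | i <- enum A] c.
    by rewrite (nth_map x).
  have := sorted_ltn_nth ltn_trans 0 srt; move=> /(_ a b); rewrite !inE !size_map.
  by rewrite !sz => /(_ isT isT ab); rewrite -(ntE x0) -(ntE y0).
have gP : [forall a : 'I_k, forall b : 'I_k,
    (a < b)%N ==> ([ffun a => g a] a < [ffun a => g a] b)%N].
  by apply/'forall_forallP => a b; apply/implyP => ab; rewrite !ffunE; exact: gincr.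
pose s0 (a : 'I_k) : 'I_k := cast_ord cA (enum_rank_in (fA a) (f a)).
have gs0 a : g (s0 a) = f a.
  by rewrite /g /s0 cast_ordK enum_rankK_in.
have s0inj : injective s0 by move=> a b ab; apply: finj; rewrite -!gs0 ab.
exists (exist _ [ffun a => g a] gP), (perm s0inj) => a.
by rewrite /= ffunE permE gs0.
Qed.

(** A repeated row or column makes the determinant vanish; otherwise sorting the selections changes
    only its sign. *)
Lemma labs_det_mxsub_le m n (A : 'M[F]_(m, n)) k (f : 'I_k -> 'I_m) (g : 'I_k -> 'I_n) :
  labs (\det (mxsub f g A)) <= vnorm (@minors R F m n A k).
Proof.
have [finj|/injectivePn[a [b ab fab]]] := altP (injectiveP f); last first.
  rewrite (determinant_alternate ab) ?labs0 ?vnorm_ge0 // => j.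
  by rewrite !mxE fab.
have [ginj|/injectivePn[a [b ab gab]]] := altP (injectiveP g); last first.
  rewrite -det_tr (determinant_alternate ab) ?labs0 ?vnorm_ge0 // => j.
  by rewrite !mxE gab.
have [f' [s fs]] := injective_incr_perm finj.
have [g' [t gt]] := injective_incr_perm ginj.
have -> : mxsub f g A = row_perm s (col_perm t (mxsub (val f') (val g') A)).
  by apply/matrixP => i j; rewrite !mxE fs gt.
rewrite row_permE col_permE !det_mulmx !det_perm !labsM !labs_sign mul1r mulr1.
exact: (le_vnorm (@minors R F m n A k) (f', g')).
Qed.

Lemma vnorm_minors_mull m n (L : 'M[F]_m) (A : 'M[F]_(m, n)) k : integral_mx L ->
  vnorm (@minors R F m n (L *m A) k) <= vnorm (@minors R F m n A k).
Proof.
move=> iL; apply/vnorm_le => [|[f g]]; first exact: vnorm_ge0.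
rewrite /minors /= mxsub_mul det_mulmx_rowsub.
apply: labs_sum_le => [|phi _]; first exact: vnorm_ge0.
rewrite labsM labs_prod -[leRHS]mul1r; apply: ler_pM; rewrite ?labs_ge0 //.
- by apply: prodr_ge0 => a _; exact: labs_ge0.
- by apply: prodr_ile1 => a _; rewrite labs_ge0 mxE iL.
- have -> : rowsub phi (colsub (val g) A) = mxsub phi (val g) A.
    by apply/matrixP => i j; rewrite !mxE.
  exact: labs_det_mxsub_le.
Qed.

Lemma vnorm_minors_tr m n (A : 'M[F]_(m, n)) k :
  vnorm (@minors R F n m A^T k) <= vnorm (@minors R F m n A k).
Proof.
apply/vnorm_le => [|[f g]]; first exact: vnorm_ge0.
rewrite /minors /= -det_tr.
have -> : (mxsub (val f) (val g) A^T)^T = mxsub (val g) (val f) A.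
  by apply/matrixP => i j; rewrite !mxE.
exact: labs_det_mxsub_le.
Qed.

Lemma vnorm_minors_mulr m n (U : 'M[F]_n) (A : 'M[F]_(m, n)) k : integral_mx U ->
  vnorm (@minors R F m n (A *m U) k) <= vnorm (@minors R F m n A k).
Proof.
move=> iU; rewrite -[A *m U]trmxK trmx_mul.
apply: le_trans (vnorm_minors_tr _ _) _; apply: le_trans _ (vnorm_minors_tr _ _).
by apply: vnorm_minors_mull => i j; rewrite mxE.
Qed.

(** Multiplication by an integral matrix cannot increase the norm of the minors, and the equivalence
    can be undone over O. *)
Lemma vnorm_minors_equiv m n (A B : 'M[F]_(m, n)) k : integral_equiv A B ->
  vnorm (@minors R F m n A k) = vnorm (@minors R F m n B k).
Proof.
have h (C D : 'M[F]_(m, n)) : integral_equiv C D ->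
    vnorm (@minors R F m n D k) <= vnorm (@minors R F m n C k).
  move=> [L [L' [U [U' [[iL _ iU _] _ _ ->]]]]].
  by apply: le_trans (vnorm_minors_mulr _ _ iU) (vnorm_minors_mull _ _ iL).
by move=> AB; apply/eqP; rewrite eq_le !h //; exact: integral_equiv_sym.
Qed.

Lemma incr_map_ge k N (f : incr_map k N) (a : 'I_k) : (a <= val f a)%N.
Proof.
case: f => f fP /=; case: a => a; elim: a => // a IH ha.
have ha' : (a < k)%N by exact: ltnW.
apply: leq_ltn_trans (IH ha') _.
by have /'forall_forallP/(_ (Ordinal ha') (Ordinal ha))/implyP := fP; apply.
Qed.

(** The leading minor attains the maximum: an increasing selection [f] satisfies a <= f a and the
    diagonal decreases, so each term of the Leibniz expansion is at most the product of the first k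
    entries. *)
Lemma vnorm_minors_diag m n (dd : nat -> F) k :
  (forall i, labs (dd i.+1) <= labs (dd i)) ->
  (forall i, (minn m n <= i)%N -> dd i = 0) ->
  vnorm (@minors R F m n (diag_rect m n dd) k) = \prod_(j < k) labs (dd j).
Proof.
move=> dle dd0; have dmono i j : (i <= j)%N -> labs (dd j) <= labs (dd i).
  elim: j => [|j IH]; first by rewrite leqn0 => /eqP ->.
  by rewrite leq_eqVlt => /predU1P[->//|/IH]; exact: le_trans.
have p0 : 0 <= \prod_(j < k) labs (dd j) by apply: prodr_ge0 => j _; exact: labs_ge0.
apply/eqP; rewrite eq_le; apply/andP; split.
  apply/vnorm_le => // -[f g]; rewrite /minors /determinant.
  apply: labs_sum_le => // s _; rewrite labsM labs_sign mul1r labs_prod.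
  apply: ler_prod => a _; rewrite labs_ge0 !mxE /=; case: ifP => _.
    exact/dmono/incr_map_ge.
  by rewrite labs0 labs_ge0.
(* For k beyond [minn m n] the product contains the vanishing factor of index [minn m n]. *)
have [km|mk] := leqP k (minn m n); last first.
  by rewrite (bigD1 (Ordinal mk)) //= dd0 // labs0 mul0r vnorm_ge0.
move: km; rewrite leq_min => /andP[km kn].
have -> : \prod_(j < k) labs (dd j) =
    labs (\det (mxsub (widen_ord km) (widen_ord kn) (diag_rect m n dd))).
  have -> : mxsub (widen_ord km) (widen_ord kn) (diag_rect m n dd) = diag_mx (\row_j dd j).
    by apply/matrixP => i j; rewrite !mxE -val_eqE /=; case: eqP => //; rewrite ?mulr1n ?mulr0n.
  by rewrite det_diag labs_prod; apply: eq_bigr => j _; rewrite mxE.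
exact: labs_det_mxsub_le.
Qed.

Lemma mxrank_equiv m n (A B : 'M[F]_(m, n)) : integral_equiv A B -> \rank A = \rank B.
Proof.
have h (C D : 'M[F]_(m, n)) : integral_equiv C D -> (\rank D <= \rank C)%N.
  move=> [L [L' [U [U' [_ _ _ ->]]]]].
  by apply: leq_trans (mxrankM_maxl _ _) (mxrankM_maxr _ _).
by move=> AB; apply/eqP; rewrite eqn_leq !h //; exact: integral_equiv_sym.
Qed.

Lemma mxrank_diag_rect m n (dd : nat -> F) k :
  (forall i, (minn m n <= i)%N -> dd i = 0) ->
  (forall i, dd i = 0 -> dd i.+1 = 0) ->
  (k < \rank (diag_rect m n dd))%N = (dd k != 0).
Proof.
move=> dd0 ddS; have ddge i j : dd i = 0 -> (i <= j)%N -> dd j = 0.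
  move=> di; elim: j => [|j IH]; first by rewrite leqn0 => /eqP <-.
  by rewrite leq_eqVlt => /predU1P[<-//|/IH/ddS].
apply/idP/idP => [|dk].
  apply: contraTneq => dk; rewrite -leqNgt.
  have [km|mk] := leqP k (minn m n); last first.
    apply: leq_trans (ltnW mk); rewrite leq_min rank_leq_row; exact: rank_leq_col.
  move: km; rewrite leq_min => /andP[km kn].
  (* If entry k vanishes, so do all later ones; projecting onto the first k rows then changes
     nothing and bounds the rank by k. *)
  have -> : diag_rect m n dd = (pid_mx k : 'M[F]_m) *m diag_rect m n dd.
    apply/matrixP => i j; rewrite !mxE (bigD1 i) //= !mxE eqxx /=.
    rewrite big1 ?addr0 => [|l li]; last first.
      by rewrite !mxE eq_sym (negbTE (_ : l != i :> nat)) ?mul0r // eq_sym.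
    by case: ltnP => [_|ki]; rewrite ?mul1r // mul0r (ddge _ _ dk ki) if_same.
  by apply: leq_trans (mxrankM_maxl _ _) _; rewrite rank_pid_mx.
have km : (k < minn m n)%N by rewrite ltnNge; apply: contraNN dk => /dd0/eqP.
move: km; rewrite leq_min => /andP[km kn].
set S := mxsub (widen_ord km) (widen_ord kn) (diag_rect m n dd).
(* Conversely, the leading square block of size k + 1 is diagonal with non-zero entries, hence
   invertible. *)
have -> : k.+1 = \rank S.
  apply/esym/eqP; rewrite -[_ == _]/(row_free S) row_free_unit unitmxE unitfE.
  have -> : S = diag_mx (\row_j dd j).
    by apply/matrixP => i j; rewrite !mxE -val_eqE /=; case: eqP => //; rewrite ?mulr1n ?mulr0n.
  rewrite det_diag; apply/prodf_neq0 => j _; rewrite mxE.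
  apply: contraNneq dk => dj; apply/eqP/(ddge _ _ dj); rewrite -ltnS; exact: ltn_ord.
have -> : S = colsub (widen_ord kn) (rowsub (widen_ord km) (diag_rect m n dd)).
  by apply/matrixP => i j; rewrite !mxE.
rewrite -mxrank_tr.
set T := rowsub _ _; have -> : (colsub (widen_ord kn) T)^T = rowsub (widen_ord kn) T^T.
  by apply/matrixP => i j; rewrite !mxE.
apply: leq_trans (mxrankS (rowsub_sub _ _)) _; rewrite mxrank_tr.
exact: mxrankS (rowsub_sub _ _).
Qed.

End MinorsNorm.
(** * The matrix of the moment map *)

Section MomentMatrix.
Variables (R : realType) (F : localFieldType R).

Definition mxscale (I : finType) (m n : I -> nat) (t : F) (f : mxfam F m n) :
  mxfam F m n := fun i => t *: f i.

Lemma mxentryZ (I : finType) (m n : I -> nat) (t : F) (f : mxfam F m n) u :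
  mxentry (mxscale t f) u = t * mxentry f u.
Proof. by rewrite /mxentry mxE. Qed.

Lemma mxentry_delta (I : finType) (m n : I -> nat) (u v : mxidx m n) :
  mxentry (mxfam_delta F v) u = (u == v)%:R.
Proof. by case: u => i [k l]; rewrite /mxentry /= mxE. Qed.

Lemma mxentry_sum (I : finType) (m n : I -> nat) (J : Type) (s : seq J)
    (f : J -> mxfam F m n) u :
  mxentry (\sum_(j <- s) f j) u = \sum_(j <- s) mxentry (f j) u.
Proof. by elim: s => [|j s IH]; rewrite ?big_nil ?mxentry0 // !big_cons mxentryD IH. Qed.

Lemma mxfam_sum_delta (I : finType) (m n : I -> nat) (f : mxfam F m n) :
  f = \sum_v mxscale (mxentry f v) (mxfam_delta F v).
Proof.
apply: mxfamP => u; rewrite mxentry_sum (bigD1 u) //= big1 => [|v vu].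
  by rewrite mxentryZ mxentry_delta eqxx mulr1 addr0.
by rewrite mxentryZ mxentry_delta eq_sym (negbTE vu) mulr0.
Qed.

(** The transport is the identity for matching dimensions and the constant 0 otherwise, which is
    linear in both cases. *)
Lemma conform_mx_linear m n m' n' (A B : 'M[F]_(m', n')) (t : F) :
  conform_mx (0 : 'M[F]_(m, n)) (A + t *: B) =
  conform_mx 0 A + t *: conform_mx 0 B.
Proof.
have [/andP[/eqP mm /eqP nn]|] := boolP ((m' == m) && (n' == n)).
  by subst m' n'; rewrite !conform_mx_id.
by rewrite negb_and => h; rewrite !nonconform_mx // scaler0 addr0.
Qed.

Lemma labs_conform_mx_le m n m' n' (A : 'M[F]_(m', n')) (t : R) : 0 <= t ->
  (forall i j, labs (A i j) <= t) ->
  forall i j, labs (conform_mx (0 : 'M[F]_(m, n)) A i j) <= t.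
Proof.
move=> t0 h i j; have [/andP[/eqP mm /eqP nn]|] := boolP ((m' == m) && (n' == n)).
  by subst m' n'; rewrite conform_mx_id.
by rewrite negb_and => nc; rewrite nonconform_mx // mxE labs0.
Qed.

Variables (Q : quiver) (d : vertex Q -> nat).
Implicit Types (x : rep F d) (y : corep F d).

Lemma moment_linear_l x x' y t i :
  moment (x + mxscale t x') y i = moment x y i + t *: moment x' y i.
Proof.
rewrite /moment scalerBr addrACA -opprD !scaler_sumr -!big_split /=.
by congr (_ - _); apply: eq_bigr => a _;
  rewrite -conform_mx_linear /= ?mulmxDl ?mulmxDr -?scalemxAl -?scalemxAr.
Qed.

Lemma moment_linear_r x y y' t i :
  moment x (y + mxscale t y') i = moment x y i + t *: moment x y' i.
Proof.
rewrite /moment scalerBr addrACA -opprD !scaler_sumr -!big_split /=.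
by congr (_ - _); apply: eq_bigr => a _;
  rewrite -conform_mx_linear /= ?mulmxDl ?mulmxDr -?scalemxAl -?scalemxAr.
Qed.

Lemma col_moment x y : col_of_mxfam (moment x y) = moment_mx x *m col_of_mxfam y.
Proof.
apply/colP => i; rewrite !mxE.
pose l z := mxentry (moment x z) (enum_val i).
have lD t z z' : l (z + mxscale t z') = l z + t * l z'.
  by rewrite /l /mxentry moment_linear_r !mxE.
have l0 : l 0 = 0.
  have := lD (-1) 0 0; rewrite mulN1r subrr (_ : 0 + mxscale (-1) 0 = 0) //.
  by apply: mxfamP => u; rewrite mxentryD mxentryZ !mxentry0 mulr0 addr0.
have lsum (s : seq (mxidx (fun a : arrow Q => d (src a)) (fun a => d (tgt a)))) :
    l (\sum_(v <- s) mxscale (mxentry y v) (mxfam_delta F v)) =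
    \sum_(v <- s) mxentry y v * l (mxfam_delta F v).
  by elim: s => [|v s IH]; rewrite ?big_nil ?l0 // !big_cons addrC lD IH addrC.
rewrite [in LHS](mxfam_sum_delta y) -/(l _) lsum.
rewrite (reindex (@enum_val _ xpredT)) /=; last exact/onW_bij/enum_val_bij.
by apply: eq_bigr => v _; rewrite !mxE mulrC.
Qed.

Lemma moment_mx_linear x x' t :
  moment_mx (x + mxscale t x') = moment_mx x + t *: moment_mx x'.
Proof. by apply/matrixP => i j; rewrite !mxE /mxentry moment_linear_l !mxE. Qed.

(** The entries of the matrix are integral linear forms in x. At [t = 1] this gives integrality;
    applied to a difference with t a power of p, it shows that x modulo [w ^+ k] determines the
    matrix modulo [w ^+ k]. *)
Lemma labs_moment_mx_le x t : 0 <= t -> (forall u, labs (mxentry x u) <= t) ->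
  forall i j, labs (moment_mx x i j) <= t.
Proof.
move=> t0 hx i j; rewrite mxE; set v := enum_val j; case: (enum_val i) => /= k [a b].
have hx' c : forall i j, labs (x c i j) <= t.
  by move=> e f; exact: (hx (Tagged (fun j => ('I_(d (tgt j)) * 'I_(d (src j)))%type) (e, f))).
have hd c : forall i j, labs (mxfam_delta F v c i j) <= 1.
  by move=> e f; rewrite mxE; exact: labs_bool.
rewrite /mxentry /= /moment !mxE !summxE; apply: labsB_le; apply: labs_sum_le => // c _;
  apply: labs_conform_mx_le => // e f.
  by rewrite -[t]mulr1; apply: labs_mulmx_le; rewrite ?ler01.
by rewrite -[t]mul1r; apply: labs_mulmx_le; rewrite ?ler01.
Qed.

Lemma moment_mxB x x' : moment_mx (x - x') = moment_mx x - moment_mx x'.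
Proof.
have -> : x - x' = x + mxscale (-1) x'.
  by apply: mxfamP => u; rewrite mxentryB mxentryD mxentryZ mulN1r.
by rewrite moment_mx_linear scaleN1r.
Qed.

End MomentMatrix.
(** * Complex powers and the series defining the zeta function *)

Section ComplexPowers.
Variable R : realType.
Implicit Types (t u : R) (a b z : R[i]).
Local Notation normc := (@Normc.normc R).

Lemma normcD_le a b : normc (a + b) <= normc a + normc b.
Proof. exact: (le_normcD (a : Rcomplex R) b). Qed.

Lemma normc_ge0 a : 0 <= normc a.
Proof. by case: a => x y; rewrite /Normc.normc sqrtr_ge0. Qed.

Lemma normcX a n : normc (a ^+ n) = normc a ^+ n.
Proof. by elim: n => [|n IH]; rewrite ?expr0 ?Normc.normc1 // !exprS Normc.normcM IH. Qed.

Lemma normc_opp a : normc (- a) = normc a.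
Proof. exact: (normcN (a : Rcomplex R)). Qed.

Lemma normcB_le a b : normc (a - b) <= normc a + normc b.
Proof. by rewrite -(normc_opp b); exact: normcD_le. Qed.

Lemma normc_real t : normc t%:C = `|t|.
Proof. by rewrite /Normc.normc /= expr0n addr0 sqrtr_sqr. Qed.

Lemma Re_le_normc a : `|complex.Re a| <= normc a.
Proof.
by case: a => x y; rewrite /Normc.normc /= -sqrtr_sqr ler_wsqrtr // lerDl sqr_ge0.
Qed.

Lemma Im_le_normc a : `|complex.Im a| <= normc a.
Proof.
by case: a => x y; rewrite /Normc.normc /= -sqrtr_sqr ler_wsqrtr // lerDr sqr_ge0.
Qed.

Lemma normc_sum_le (J : Type) (s : seq J) (P : pred J) (f : J -> R[i]) :
  normc (\sum_(j <- s | P j) f j) <= \sum_(j <- s | P j) normc (f j).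
Proof.
elim/big_ind2: _ => [|a x b y ax b_y|//]; first by rewrite Normc.normc0.
exact: le_trans (normcD_le _ _) (lerD ax b_y).
Qed.

Lemma Re_natr n : complex.Re (n%:R : R[i]) = n%:R.
Proof. by rewrite -(rmorph_nat (real_complex R)). Qed.

Lemma Im_natr n : complex.Im (n%:R : R[i]) = 0.
Proof. by rewrite -(rmorph_nat (real_complex R)). Qed.

Lemma Re_addc a b : complex.Re (a + b) = complex.Re a + complex.Re b.
Proof. by case: a; case: b. Qed.
Lemma Im_addc a b : complex.Im (a + b) = complex.Im a + complex.Im b.
Proof. by case: a; case: b. Qed.
Lemma Re_oppc a : complex.Re (- a) = - complex.Re a.
Proof. by case: a. Qed.
Lemma Im_oppc a : complex.Im (- a) = - complex.Im a.
Proof. by case: a. Qed.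
Lemma Re_mulc a b : complex.Re (a * b) =
  complex.Re a * complex.Re b - complex.Im a * complex.Im b.
Proof. by case: a; case: b. Qed.
Lemma Im_mulc a b : complex.Im (a * b) =
  complex.Re a * complex.Im b + complex.Im a * complex.Re b.
Proof. by case: a; case: b. Qed.

Lemma normc_cpow t z : normc (cpow t z) = t `^ complex.Re z.
Proof.
rewrite /cpow Normc.normcM normc_real ger0_norm ?powR_ge0 //.
by rewrite /Normc.normc cos2Dsin2 sqrtr1 mulr1.
Qed.

Lemma cpow1 z : cpow 1 z = 1.
Proof. by rewrite /cpow powR1 ln1 mulr0 cos0 sin0 mul1r. Qed.

Lemma cpow0 z : complex.Re z != 0 -> cpow 0 z = 0.
Proof. by move=> z0; rewrite /cpow powR0 // mul0r. Qed.

Lemma cpowD t a b : 0 < t -> cpow t (a + b) = cpow t a * cpow t b.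
Proof.
move=> t0; rewrite /cpow Re_addc Im_addc.
have -> : t `^ (complex.Re a + complex.Re b) = t `^ complex.Re a * t `^ complex.Re b.
  by rewrite powRD //; apply/implyP => _; rewrite gt_eqF.
rewrite mulrDl.
rewrite cosD sinD rmorphM mulrACA; congr (_ * _).
by apply/eqP; rewrite eq_complex Re_mulc Im_mulc /= eqxx /= addrC mulrC [X in _ + X]mulrC addrC.
Qed.

Lemma cpowM t u z : 0 < t -> 0 < u -> cpow (t * u) z = cpow t z * cpow u z.
Proof.
move=> t0 u0; rewrite /cpow powRM ?ltW // lnM ?posrE // mulrDr.
rewrite cosD sinD rmorphM mulrACA; congr (_ * _).
by apply/eqP; rewrite eq_complex Re_mulc Im_mulc /= eqxx /= addrC mulrC [X in _ + X]mulrC addrC.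
Qed.

Lemma cpowX t z n : 0 < t -> cpow (t ^+ n) z = cpow t z ^+ n.
Proof.
move=> t0; elim: n => [|n IH]; first by rewrite !expr0 cpow1.
by rewrite !exprS cpowM ?exprn_gt0 // IH.
Qed.

Lemma cpowV t z : 0 < t -> cpow t^-1 z = cpow t (- z).
Proof.
move=> t0; rewrite /cpow Re_oppc Im_oppc powRN mulNr -mulrN -lnV ?posrE //.
by congr (_ %:C * _); rewrite -powR_inv1 ?ltW // -powRrM mulN1r powRN.
Qed.

Lemma cpow_opp_nat t n : 0 < t -> cpow t (- n%:R) = (t^-1 ^+ n)%:C.
Proof.
move=> t0; rewrite -cpowV // /cpow Re_natr Im_natr mul0r cos0 sin0 complexr0.
by rewrite mulr1 powR_mulrn // invr_ge0 ltW.
Qed.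

End ComplexPowers.

(** * Truncated geometric series *)

Section GeometricSums.
Variable K : fieldType.

Lemma sum_expr_nat (x : K) c d : (c <= d)%N -> 1 - x != 0 ->
  \sum_(c <= k < d) x ^+ k = (x ^+ c - x ^+ d) / (1 - x).
Proof.
move=> cd x1; apply: (mulIf x1); rewrite mulfVK // mulr_suml.
under eq_bigr do rewrite mulrBr mulr1 -exprSr.
have := @telescope_sumr K c d (fun k => - x ^+ k) cd.
rewrite opprK addrC => <-; apply: eq_bigr => k _.
by rewrite opprK addrC.
Qed.

(* On the block b i <= k < b (i + 1) exactly the first i truncated differences
   are positive, so the summand is a geometric progression of ratio z p^i. *)
Lemma sum_truncated_geometric (z p : K) (r : nat) (b : nat -> nat) :
  p != 0 -> (forall i, (i <= r)%N -> 1 - z * p ^+ i != 0) ->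
  b 0 = 0 -> (forall i, (i <= r)%N -> (b i <= b i.+1)%N) ->
  \sum_(k < b r.+1) (1 - z) * z ^+ k * p ^+ (\sum_(j < r) (k.+1 - b j.+1)) =
  \sum_(i < r.+1) p ^+ i * (1 - z) / (1 - z * p ^+ i) *
    (((z * p ^+ i) ^+ b i - (z * p ^+ i) ^+ b i.+1) / p ^+ (\sum_(j < i) b j.+1)).
Proof.
move=> p0 z1 b0 bS.
have bmono i j : (i <= j)%N -> (j <= r.+1)%N -> (b i <= b j)%N.
  move=> ij; elim: j ij => [|j IH]; first by rewrite leqn0 => /eqP ->.
  rewrite leq_eqVlt => /predU1P[->//|ij] jr.
  by apply: leq_trans (bS j _) => //; apply: IH => //; exact: ltnW.
suff h m : (m <= r.+1)%N ->
    \sum_(0 <= k < b m) (1 - z) * z ^+ k * p ^+ (\sum_(j < r) (k.+1 - b j.+1)) =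
    \sum_(i < m) p ^+ i * (1 - z) / (1 - z * p ^+ i) *
    (((z * p ^+ i) ^+ b i - (z * p ^+ i) ^+ b i.+1) / p ^+ (\sum_(j < i) b j.+1)).
  by rewrite -h // big_mkord.
elim: m => [|m IH] mr; first by rewrite b0 big_geq // big_ord0.
rewrite big_ord_recr /= -IH ?(ltnW mr) // (@big_cat_nat _ _ _ (b m)) //=; last exact: bS.
congr (_ + _).
have e k : (b m <= k < b m.+1)%N -> (1 - z) * z ^+ k * p ^+ (\sum_(j < r) (k.+1 - b j.+1)) =
    (1 - z) * p ^+ m / p ^+ (\sum_(j < m) b j.+1) * (z * p ^+ m) ^+ k.
  move=> /andP[bk kb].
  have -> : (\sum_(j < r) (k.+1 - b j.+1) = \sum_(j < m) (k.+1 - b j.+1))%N.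
    rewrite [RHS](big_ord_widen r (fun j => (k.+1 - b j.+1)%N)) //.
    rewrite [RHS]big_mkcond; apply: eq_bigr => j _; case: ltnP => // mj.
    by apply/eqP; rewrite subn_eq0; apply: leq_trans kb _; apply: bmono; rewrite ltnS // ltnW.
  (* For j < m the subtraction is not truncated on this block, so the exponent of p is m (k + 1)
     minus the sum of the breakpoints. *)
  have : (\sum_(j < m) (k.+1 - b j.+1) + \sum_(j < m) b j.+1 = m * k.+1)%N.
    rewrite -big_split /= -[in RHS](card_ord m) -sum_nat_const; apply: eq_bigr => j _.
    rewrite subnK // ltnW // ltnS; apply: leq_trans bk.
    by apply: bmono => //; exact: ltnW.
  move=> eqs; apply: (mulIf (expf_neq0 (\sum_(j < m) b j.+1)%N p0)).
  rewrite -[LHS]mulrA -exprD eqs exprMn -exprM.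
  by rewrite [RHS]mulrAC mulfVK ?expf_neq0 // mulnS exprD; ring.
rewrite big_nat_cond; under eq_bigr => k do [rewrite andbT => /e ->].
rewrite -big_nat_cond -mulr_sumr sum_expr_nat ?z1 ?bS //.
by rewrite -!mulrA; ring.
Qed.

End GeometricSums.

(** * Series at a fixed point, with error bounds *)

Section ZetaApproximation.
Variables (R : realType) (F : localFieldType R) (s : R[i]).
Hypothesis Re_s_gt0 : 0 < complex.Re s.
Local Notation q := ((residue_card F)%:R : R).
Local Notation p := (q^-1).
Local Notation normc := (@Normc.normc R).
Local Notation z := (cpow q (- s)).
Local Notation rho := (q `^ (- complex.Re s)).

Lemma expr_small (x e : R) : 0 <= x -> x < 1 -> 0 < e ->
  exists N, forall n, (N <= n)%N -> x ^+ n < e.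
Proof.
move=> x0 x1 e0; have /cvgrPdist_lt/(_ _ e0)[N _ h] : (fun k => x ^+ k) @ \oo --> (0 : R).
  by apply: cvg_expr; rewrite ger0_norm.
exists N => n /h; rewrite sub0r normrN ger0_norm //; exact: exprn_ge0.
Qed.

Lemma rho_gt0 : 0 < rho. Proof. by rewrite powR_gt0 ?q_gt0. Qed.

Lemma rho_lt1 : rho < 1.
Proof.
rewrite /powR gt_eqF ?q_gt0 // expR_lt1 mulNr oppr_lt0 mulr_gt0 //.
by rewrite ln_gt0 // q_gt1.
Qed.

Lemma normc_z : normc z = rho.
Proof. by rewrite normc_cpow Re_oppc. Qed.

Lemma cpow_pX (a : R[i]) k : cpow (p ^+ k) a = cpow q (- a) ^+ k.
Proof. by rewrite cpowX ?p_gt0 // cpowV ?q_gt0. Qed.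

Lemma cpow_q_shift i : cpow q (- (s + i%:R)) = z * (p ^+ i)%:C.
Proof. by rewrite opprD cpowD ?q_gt0 // cpow_opp_nat ?q_gt0. Qed.

Lemma normc_zp i : normc (z * (p ^+ i)%:C) <= rho.
Proof.
rewrite Normc.normcM normc_z normc_real ger0_norm ?pX_ge0 //.
by rewrite ler_piMr ?pX_le1 // ltW ?rho_gt0.
Qed.

Lemma subz_neq0 i : 1 - z * (p ^+ i)%:C != 0.
Proof.
rewrite subr_eq0; apply: contraTneq (normc_zp i) => <-.
by rewrite Normc.normc1 -ltNge rho_lt1.
Qed.

(** A telescoping sum that stops at min(n, K). For X = p^K the condition X <= p^(k+1) means k < K,
    so this evaluates the truncated series of X^s. *)
Lemma sum_step n K :
  1 - \sum_(k < n) (1 - z) * z ^+ k * (k < K)%N%:R = z ^+ minn n K.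
Proof.
elim: n => [|n IH]; first by rewrite big_ord0 min0n subr0 expr0.
rewrite big_ord_recr /= opprD addrA IH; case: ltnP => nK.
  by rewrite (minn_idPl nK) mulr1 exprS; ring.
by rewrite mulr0 subr0 (minn_idPr (leqW nK)).
Qed.

Definition level (X : R) := X = 0 \/ exists k, X = p ^+ k.

Lemma cpow_level_approx X n : level X ->
  normc (cpow X s - (1 - \sum_(k < n) (1 - z) * z ^+ k * (X <= p ^+ k.+1)%R%:R))
  <= 2 / (1 - rho) * rho ^+ n.
Proof.
move=> lX; have r0 := rho_gt0; have r1 := rho_lt1.
(* The bound [2 * rho ^+ n] holds here already; the factor 1 / (1 - rho) >= 1 only matches the error
   on the side of the fibers. *)
suff : normc (cpow X s - (1 - \sum_(k < n) (1 - z) * z ^+ k * (X <= p ^+ k.+1)%R%:R))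
    <= 2 * rho ^+ n.
  move/le_trans; apply; rewrite ler_pM2r ?exprn_gt0 // ler_peMr //.
  by rewrite invf_ge1 ?subr_gt0 // gerBl ltW.
have rn m : normc (z ^+ m) = rho ^+ m by rewrite normcX normc_z.
have [->|[K ->]] := lX.
  (* At X = 0 all n indicators equal 1, so the error is z^n up to sign. *)
  rewrite cpow0 ?gt_eqF // (eq_bigr (fun k : 'I_n => (1 - z) * z ^+ k * (k < n)%N%:R)).
    rewrite sum_step minnn sub0r normc_opp rn ler_peMl ?exprn_ge0 ?ltW //.
    by rewrite ltr1n.
  by move=> k _; rewrite ltn_ord pX_ge0.
under eq_bigr do rewrite ler_pX.
rewrite sum_step cpow_pX; case: (leqP n K) => nK.
  apply: le_trans (normcB_le _ _) _; rewrite !rn mulr2n mulrDl mul1r lerD2r.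
  by rewrite ler_wiXn2l // ltW.
by rewrite subrr Normc.normc0 mulr_ge0 // exprn_ge0 ?ltW.
Qed.

(** * Absolute values [lam] of elementary divisors and norms [Dl] of minors at a fixed point *)

Variables (r : nat) (lam : nat -> R) (Dl : int -> R).
Hypothesis lam_ge0 : forall j, 0 <= lam j.
Hypothesis lam_le1 : forall j, lam j <= 1.
Hypothesis lam_mono : forall j, lam j.+1 <= lam j.
Hypothesis lam_r : lam r = 0.
Hypothesis Dl_prod : forall i : nat, (i <= r.+1)%N -> Dl i = \prod_(j < i) lam j.
Hypothesis Dl_m1 : Dl (-1) = 1.

Definition zeta_integrand (i : nat) : R[i] :=
  (cpow (Dl i / Dl (i%:Z - 1)) (s + i%:R) - cpow (Dl (i%:Z + 1) / Dl i) (s + i%:R))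
    / (Dl i)%:C.

Lemma Dl_ratio_next i : (i <= r)%N -> Dl i != 0 -> Dl (i%:Z + 1) / Dl i = lam i.
Proof.
move=> ir Di; have -> : i%:Z + 1 = i.+1%:Z by rewrite intS addrC.
rewrite Dl_prod // big_ord_recr /= -Dl_prod ?(leqW ir) //.
by rewrite mulrC mulKf.
Qed.

Lemma Dl_ratio_prev i : (i <= r)%N -> Dl i != 0 ->
  Dl i / Dl (i%:Z - 1) = if i is i'.+1 then lam i' else 1.
Proof.
case: i => [|i] ir; first by rewrite sub0r Dl_m1 Dl_prod // big_ord0 divr1.
have -> : i.+1%:Z - 1 = i%:Z by rewrite intS addrC addKr.
rewrite !Dl_prod ?(leqW (ltnW ir)) ?leqW // big_ord_recr /= mulf_eq0 negb_or.
by case/andP => P0 _; rewrite mulrC mulKf.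
Qed.

Lemma lam_anti i j : (i <= j)%N -> lam j <= lam i.
Proof.
elim: j => [|j IH]; first by rewrite leqn0 => /eqP ->.
by rewrite leq_eqVlt => /predU1P[->//|/IH]; exact: le_trans.
Qed.

(** Each base is at most 1 and at most each of the i factors of [Dl i]; its i-th power is thus at
    most [Dl i], which offsets the denominator. Where [Dl i = 0], the inverse is 0. *)
Lemma normc_zeta_integrand i : (i <= r)%N -> normc (zeta_integrand i) <= 2.
Proof.
move=> ir; rewrite /zeta_integrand.
have [->|Di] := eqVneq (Dl i) 0.
  by rewrite (rmorph0 (real_complex R)) !invr0 !mulr0 Normc.normc0.
rewrite Dl_ratio_next // Dl_ratio_prev //.
have Dgt : 0 < Dl i.
  by rewrite lt_def Di Dl_prod ?leqW //; apply: prodr_ge0 => j _.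
have bound u : 0 <= u -> u <= 1 -> (forall j, (j < i)%N -> u <= lam j) ->
    normc (cpow u (s + i%:R)) <= Dl i.
  move=> u0 u1 uj; rewrite normc_cpow Re_addc Re_natr.
  have [->|un] := eqVneq u 0.
    by rewrite powR0 ?(ltW Dgt) // gt_eqF // ltr_wpDr.
  rewrite powRD; last by apply/implyP.
  rewrite powR_mulrn //.
  have ple : u `^ complex.Re s <= 1.
    rewrite -[leRHS](powRr0 u); apply: (ger_powR (_ : 0 < u <= 1)); last exact: ltW.
    by rewrite lt_def un u0 u1.
  apply: le_trans (ler_piMl (exprn_ge0 _ u0) ple) _.
  rewrite Dl_prod ?leqW // -[i in u ^+ i]card_ord -prodr_const.
  by apply: ler_prod => j _; rewrite u0 uj.
rewrite Normc.normcM -(rmorphV _) ?unitfE // normc_real ger0_norm ?invr_ge0 ?(ltW Dgt) //.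
rewrite ler_pdivrMr //; apply: le_trans (normcB_le _ _) _.
rewrite mulr2n mulrDl mul1r; apply: lerD; apply: bound => //.
- by case: (i).
- by case: (i).
- by case: (i) => // i' j; rewrite ltnS; exact: lam_anti.
- by move=> j /ltnW; exact: lam_anti.
Qed.

Variable a : nat -> nat.
Hypothesis lam_level : forall j, (j < r)%N -> lam j = p ^+ a j.

(* The term i = r of the main sum has b (r + 1) = oo in place of N, which costs
   c r (z p^r)^N / p^A; the bound does not see it since N is arbitrary. *)
Lemma zeta_fiber_approx n :
  normc ((1 - \sum_(i < r.+1) cpow q (- i%:R) * (1 - z) / (1 - cpow q (- (s + i%:R)))
              * zeta_integrand i) -
         (1 - \sum_(k < n) (1 - z) * z ^+ k * (p ^+ (\sum_(j < r) (k.+1 - a j)))%:C))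
  <= 2 / (1 - rho) * rho ^+ n.
Proof.
have r0 := rho_gt0; have r1 := rho_lt1.
pose pc : R[i] := p%:C.
have pcX k : (p ^+ k)%:C = pc ^+ k by rewrite /pc rmorphXn.
have pc0 : pc != 0.
  by rewrite /pc; apply/eqP => /complexI/eqP; rewrite (negbTE (p_neq0 F)).
pose S N := \sum_(k < N) (1 - z) * z ^+ k * pc ^+ (\sum_(j < r) (k.+1 - a j)).
pose c (i : nat) := pc ^+ i * (1 - z) / (1 - z * pc ^+ i).
pose A := \sum_(j < r) a j.
have am j : (j.+1 < r)%N -> (a j <= a j.+1)%N.
  by move=> jr; rewrite -(ler_pX F) -!lam_level // ltnW.
have Dli i : (i <= r)%N -> Dl i = p ^+ (\sum_(j < i) a j).
  move=> ir; rewrite Dl_prod ?leqW // (big_morph _ (exprD p) (expr0 p)).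
  by apply: eq_bigr => j _; rewrite lam_level // (leq_trans _ ir).
have main N : (forall j, (j < r)%N -> (a j <= N)%N) ->
    \sum_(i < r.+1) cpow q (- i%:R) * (1 - z) / (1 - cpow q (- (s + i%:R))) * zeta_integrand i
    = S N + c r * ((z * pc ^+ r) ^+ N / pc ^+ A).
  move=> aN; pose b i := if i is i'.+1 then (if (i' < r)%N then a i' else N) else 0%N.
  have bS i : (i <= r)%N -> (b i <= b i.+1)%N.
    case: i => [|i] //= ir; rewrite ir; case: ltnP => ir'; [exact: am|exact: aN].
  have := @sum_truncated_geometric _ z pc r b pc0 _ erefl bS.
  have bE k : (\sum_(j < r) (k.+1 - b j.+1) = \sum_(j < r) (k.+1 - a j))%N.
    by apply: eq_bigr => j _; rewrite /= ltn_ord.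
  under eq_bigr do rewrite bE.
  have -> : b r.+1 = N by rewrite /= ltnn.
  rewrite -/(S N) => ->; last by move=> i _; rewrite -pcX subz_neq0.
  have term i : (i <= r)%N -> cpow q (- i%:R) * (1 - z) / (1 - cpow q (- (s + i%:R))) *
      zeta_integrand i = c i * (((z * pc ^+ i) ^+ b i -
      (if (i < r)%N then (z * pc ^+ i) ^+ b i.+1 else 0)) / pc ^+ (\sum_(j < i) b j.+1)).
    move=> ir; rewrite cpow_opp_nat ?q_gt0 // cpow_q_shift !pcX -/(c i); congr (_ * _).
    have Di0 : Dl i != 0 by rewrite Dli // expf_neq0 ?p_neq0.
    rewrite /zeta_integrand Dl_ratio_next // Dl_ratio_prev // Dli // pcX.
    congr ((_ - _) / pc ^+ _).
    - case: i ir {Di0} => [|i] ir /=; first by rewrite cpow1 expr0.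
      by rewrite lam_level // cpow_pX cpow_q_shift pcX ir.
    (* For i = r the second base is [lam r = 0], whose power vanishes as Re s + r > 0. *)
    - rewrite /=; case: ltnP => ir'; first by rewrite lam_level // cpow_pX cpow_q_shift pcX.
      have -> : i = r by apply/eqP; rewrite eqn_leq ir.
      by rewrite lam_r cpow0 // gt_eqF // Re_addc Re_natr ltr_wpDr.
    - by apply: eq_bigr => j _; rewrite /= (leq_trans (ltn_ord j)).
  rewrite big_ord_recr [in RHS]big_ord_recr /= -addrA; congr (_ + _).
    by apply: eq_bigr => i _; rewrite (term _ (ltnW (ltn_ord i))) /c /= ltn_ord.
  have bA : (\sum_(j < r) (if j < r then a j else N) = A)%N.
    by apply: eq_bigr => j _; rewrite ltn_ord.
  by rewrite term //= bA ltnn subr0 /c -mulrDr -mulrDl subrK.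
under [X in _ - (1 - X)]eq_bigr do rewrite pcX.
rewrite -/(S n); pose B := normc (c r / pc ^+ A).
have B0 : 0 <= B by exact: normc_ge0.
apply/ler_addgt0Pr => e e0.
have eB : 0 < e / (B + 1) by rewrite divr_gt0 // ltr_wpDl.
have [N1 N1P] := expr_small (ltW r0) r1 eB.
(* N passes n, every [a j], and the threshold from which the extra term of [main] is below e. *)
pose N := maxn n (maxn N1 (\max_(j < r) a j)).
have nN : (n <= N)%N by exact: leq_maxl.
rewrite (main N) => [|j jr]; last first.
  by rewrite !leq_max (leq_bigmax (Ordinal jr)) !orbT.
have -> : 1 - (S N + c r * ((z * pc ^+ r) ^+ N / pc ^+ A)) - (1 - S n) =
   - ((S N - S n) + (c r / pc ^+ A) * (z * pc ^+ r) ^+ N) by ring.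
rewrite normc_opp; apply: le_trans (normcD_le _ _) _; apply: lerD.
  have -> : S N - S n = \sum_(n <= k < N) (1 - z) * z ^+ k * pc ^+ (\sum_(j < r) (k.+1 - a j)).
    pose f k := (1 - z) * z ^+ k * pc ^+ (\sum_(j < r) (k.+1 - a j)).
    have SE M : S M = \sum_(0 <= k < M) f k by rewrite big_mkord.
    by apply: (addrI (S n)); rewrite addrC subrK !SE; exact: big_cat_nat.
  apply: le_trans (normc_sum_le _ _ _) _.
  (* As |1 - z| <= 2 and the power of p is at most 1, the tail is dominated by a geometric one,
     whose sum is the source of the constant 2 / (1 - rho). *)
  apply: (@le_trans _ _ (\sum_(n <= k < N) 2 * rho ^+ k)).
    apply: ler_sum => k _; rewrite -pcX !Normc.normcM !normcX normc_z normc_real.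
    rewrite ger0_norm ?pX_ge0 // -[leRHS]mulr1; apply: ler_pM; rewrite ?pX_ge0 ?pX_le1 //.
      by rewrite mulr_ge0 ?normc_ge0 // exprn_ge0 ?ltW.
    rewrite ler_pM2r ?exprn_gt0 //; apply: le_trans (normcB_le _ _) _.
    by rewrite Normc.normc1 normc_z -[2]/(1 + 1) lerD2l ltW.
  rewrite -mulr_sumr sum_expr_nat ?subr_eq0 ?gt_eqF // -mulrA.
  rewrite ler_pM2l // [leRHS]mulrC ler_pM2r ?invr_gt0 ?subr_gt0 // gerBl.
  by rewrite exprn_ge0 // ltW.
rewrite Normc.normcM -/B normcX; apply: (@le_trans _ _ (B * rho ^+ N)).
  by rewrite ler_wpM2l // lerXn2r ?nnegrE ?normc_ge0 ?(ltW r0) // -pcX normc_zp.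
apply: (@le_trans _ _ (B * (e / (B + 1)))).
  by rewrite ler_wpM2l // ltW // N1P // /N !leq_max leqnn orbT.
rewrite mulrA ler_pdivrMr ?ltr_wpDl // mulrC ler_wpM2l ?(ltW e0) //.
by rewrite lerDl.
Qed.

End ZetaApproximation.
(** * Integrals of complex functions *)

Section ComplexIntegralTheory.
Context (disp : measure_display) (T : measurableType disp) (R : realType).
Variables (mu : {measure set T -> \bar R}) (D : set T).
Hypothesis mD : measurable D.
Hypothesis muD1 : mu D = 1%E.
Local Notation normc := (@Normc.normc R).
Implicit Types f g : T -> R[i].

Let muDfin : (mu D < +oo)%E. Proof. by rewrite muD1 ltry. Qed.

Lemma integrable_bounded (f : T -> R) (M : R) : measurable_fun D f ->
  (forall x, D x -> `|f x| <= M) -> mu.-integrable D (EFin \o f).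
Proof.
move=> mf fM; apply: measurable_bounded_integrable => //.
exists M; split; first exact: num_real.
by move=> N MN x Dx; apply: le_trans (ltW MN); exact: fM.
Qed.

Lemma Rintegral_close (f g : T -> R) (e : R) : 0 <= e ->
  mu.-integrable D (EFin \o f) -> mu.-integrable D (EFin \o g) ->
  {ae mu, forall x, D x -> `|f x - g x| <= e} ->
  `|Rintegral mu D f - Rintegral mu D g| <= e.
Proof.
move=> e0 fi gi fg; rewrite -RintegralB //.
have fgi : mu.-integrable D (EFin \o (fun x => f x - g x)).
  exact: (integrableB mD fi gi).
rewrite -lee_fin; have -> : `|Rintegral mu D (fun x => f x - g x)|%:E =
   `|\int[mu]_(x in D) (f x - g x)%:E|%E by rewrite EFin_normr_Rintegral.
apply: le_trans (le_abse_integral _ _ _) _ => //; first exact: measurable_int fgi.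
have -> : e%:E = (\int[mu]_(x in D) e%:E)%E by rewrite integral_cst // muD1 mule1.
have mfg : measurable_fun D (fun x => f x - g x).
  by apply/measurable_EFinP; exact: measurable_int fgi.
apply: ae_ge0_le_integral => //.
- by apply: measurableT_comp => //; exact/measurable_EFinP.
Qed.

Lemma cintegral_subZ f g (c : R[i]) : cintegrable mu D f -> cintegrable mu D g ->
  cintegrable mu D (fun x => f x - c * g x) /\
  cintegral mu D (fun x => f x - c * g x) = cintegral mu D f - c * cintegral mu D g.
Proof.
move=> [fr fi] [gr gi].
have ReE x : complex.Re (f x - c * g x) =
    complex.Re (f x) - (complex.Re c * complex.Re (g x) - complex.Im c * complex.Im (g x)).
  by rewrite Re_addc Re_oppc Re_mulc.
have ImE x : complex.Im (f x - c * g x) =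
    complex.Im (f x) - (complex.Re c * complex.Im (g x) + complex.Im c * complex.Re (g x)).
  by rewrite Im_addc Im_oppc Im_mulc.
have Zi (a : R) (h : T -> R) : mu.-integrable D (EFin \o h) ->
    mu.-integrable D (EFin \o (fun x => a * h x)).
  exact: integrableZl.
have Bi (h k : T -> R) : mu.-integrable D (EFin \o h) -> mu.-integrable D (EFin \o k) ->
    mu.-integrable D (EFin \o (fun x => h x - k x)).
  exact: integrableB.
have Di (h k : T -> R) : mu.-integrable D (EFin \o h) -> mu.-integrable D (EFin \o k) ->
    mu.-integrable D (EFin \o (fun x => h x + k x)).
  exact: integrableD.
split.
  split.
    have -> : (fun x => (complex.Re (f x - c * g x))%:E) = EFin \o (fun x =>
        complex.Re (f x) - (complex.Re c * complex.Re (g x) - complex.Im c * complex.Im (g x))).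
      by apply/funext => x; rewrite /= ReE.
    by apply: (Bi _ _ fr); apply: Bi; exact: Zi.
  have -> : (fun x => (complex.Im (f x - c * g x))%:E) = EFin \o (fun x =>
      complex.Im (f x) - (complex.Re c * complex.Im (g x) + complex.Im c * complex.Re (g x))).
    by apply/funext => x; rewrite /= ImE.
  by apply: (Bi _ _ fi); apply: Di; exact: Zi.
rewrite /cintegral; apply/eqP; rewrite eq_complex; apply/andP; split; apply/eqP => /=.
  under eq_Rintegral do rewrite ReE.
  rewrite Re_addc Re_oppc Re_mulc /= RintegralB //; last by apply: Bi; exact: Zi.
  by rewrite RintegralB ?RintegralZl //; exact: Zi.
under eq_Rintegral do rewrite ImE.
rewrite Im_addc Im_oppc Im_mulc /= RintegralB //; last by apply: Di; exact: Zi.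
by rewrite RintegralD ?RintegralZl //; exact: Zi.
Qed.

Lemma cintegral_cst (c : R[i]) :
  cintegrable mu D (fun=> c) /\ cintegral mu D (fun=> c) = c.
Proof.
split; first by split; apply: (@integrable_bounded (fun=> _) `|_|) => //.
by rewrite /cintegral !Rintegral_cst // muD1 !mulr1; case: c.
Qed.

(** The shape 1 minus a finite sum is shared by the right-hand side of the formula and by the
    truncated series on both sides. *)
Lemma cintegral_affine (n : nat) (c : nat -> R[i]) (g : nat -> T -> R[i]) :
  (forall k, (k < n)%N -> cintegrable mu D (g k)) ->
  cintegrable mu D (fun x => 1 - \sum_(k < n) c k * g k x) /\
  cintegral mu D (fun x => 1 - \sum_(k < n) c k * g k x) =
  1 - \sum_(k < n) c k * cintegral mu D (g k).
Proof.
elim: n => [|n IH] gi.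
  rewrite big_ord0 subr0; under eq_fun do rewrite big_ord0 subr0.
  exact: cintegral_cst.
have [i1 e1] := IH (fun k kn => gi k (ltnW kn)).
have [i2 e2] := cintegral_subZ (c n) i1 (gi n (ltnSn n)).
rewrite big_ord_recr /= opprD addrA -e1 -e2.
by under eq_fun do rewrite big_ord_recr /= opprD addrA.
Qed.

Lemma cintegral_close f g (e : R) : 0 <= e -> cintegrable mu D f -> cintegrable mu D g ->
  {ae mu, forall x, D x -> normc (f x - g x) <= e} ->
  `|complex.Re (cintegral mu D f) - complex.Re (cintegral mu D g)| <= e /\
  `|complex.Im (cintegral mu D f) - complex.Im (cintegral mu D g)| <= e.
Proof.
move=> e0 [fr fi] [gr gi] fg; split; apply: Rintegral_close => //.
  apply: filterS fg => x fg Dx; apply: le_trans (fg Dx).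
  by rewrite -Re_oppc -Re_addc Re_le_normc.
apply: filterS fg => x fg Dx; apply: le_trans (fg Dx).
by rewrite -Im_oppc -Im_addc Im_le_normc.
Qed.

Lemma cintegral_real (g : T -> R) :
  cintegral mu D (fun x => (g x)%:C) = (Rintegral mu D g)%:C.
Proof. by rewrite /cintegral /= Rintegral_cst // mul0r complexr0. Qed.

End ComplexIntegralTheory.

Lemma complex_eq_approx (R : realType) (u v : R[i]) (w : nat -> R[i]) (e : nat -> R) :
  (forall eps, 0 < eps -> exists n, e n < eps) ->
  (forall n, `|complex.Re u - complex.Re (w n)| <= e n /\
             `|complex.Im u - complex.Im (w n)| <= e n) ->
  (forall n, `|complex.Re v - complex.Re (w n)| <= e n /\
             `|complex.Im v - complex.Im (w n)| <= e n) -> u = v.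
Proof.
move=> e0 hu hv.
have real_eq (a b : R) (c : nat -> R) : (forall n, `|a - c n| <= e n) ->
    (forall n, `|b - c n| <= e n) -> a = b.
  move=> ha hb; apply/eqP; rewrite -subr_eq0 -normr_le0; apply/ler_addgt0Pr => d d0.
  have [n /ltW en] := e0 (d / 2) (divr_gt0 d0 (ltr0Sn R 1)).
  rewrite add0r (splitr d) -(subrK (c n) a) -addrA.
  apply: le_trans (ler_normD _ _) _; apply: lerD; first exact: le_trans (ha n) en.
  by rewrite distrC; exact: le_trans (hb n) en.
apply/eqP; rewrite eq_complex; apply/andP; split; apply/eqP.
  by apply: (real_eq _ _ (fun n => complex.Re (w n))) => n; [case: (hu n)|case: (hv n)].
by apply: (real_eq _ _ (fun n => complex.Im (w n))) => n; [case: (hu n)|case: (hv n)].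
Qed.
(** * Level sets and their fibers *)

Lemma translate0 (V : zmodType) (S : set V) : [set f | S (f - 0)] = S.
Proof. by apply/funext => f; rewrite /mkset subr0. Qed.

Section IntegralPoints.
Variables (R : realType) (F : localFieldType R).
Local Notation q := ((residue_card F)%:R : R).
Local Notation p := (q^-1).

Section OneFamily.
Variables (I : finType) (m n : I -> nat).
Local Notation V := (mxfam F m n).
Local Notation O := (@mxfam_integral R F I m n).
Implicit Types f g : V.

Lemma mxcong_sym k f g : mxcong k f g -> mxcong k g f.
Proof. by move=> h u; rewrite labs_distC. Qed.

Lemma mxcong_trans k f g h : mxcong k f g -> mxcong k g h -> mxcong k f h.
Proof.
move=> fg gh u; rewrite -(subrK (mxentry g u) (mxentry h u)) -addrA.
exact: labsD_le.
Qed.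

Lemma mxcong_integral k f g : mxcong k f g -> O f -> O g.
Proof.
move=> fg Of u; rewrite -(subrK (mxentry f u) (mxentry g u)).
by apply: labsD_le (Of u); apply: le_trans (fg u) (pX_le1 _ _).
Qed.

Lemma mxfam_integralD f g : O f -> O g -> O (f + g).
Proof. by move=> hf hg u; rewrite mxentryD; apply: labsD_le. Qed.

Lemma mxfam_integralN f : O f -> O (- f).
Proof. by move=> hf u; rewrite mxentryN labsN. Qed.

Lemma mxfam_integral0 : O 0.
Proof. by move=> u; rewrite mxentry0 labs0 ler01. Qed.

Definition mxball (k : nat) : set V := mxcong k 0.

Lemma mxballB k f g : mxball k (f - g) <-> mxcong k g f.
Proof.
by split=> h u; have := h u; rewrite mxentryB mxentry0 subr0.
Qed.

Lemma mxball_stable k f g : mxcong k f g -> mxball k f -> mxball k g.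
Proof.
move=> fg f0 u; rewrite -(subrK (mxentry f u) (mxentry g u)) -addrA.
exact: labsD_le.
Qed.

Lemma integral_col f : O f <-> forall i, labs (col_of_mxfam f i 0) <= 1.
Proof.
split=> [h i|h u]; first by rewrite mxE; exact: h.
by have := h (enum_rank u); rewrite mxE enum_rankK.
Qed.

(** Only finiteness of the index N matters: N times the volume of the ball is 1, and N cancels
    afterwards. *)
Lemma transversal_mxball k : exists N (e : 'I_N -> V), transversal O (mxball k) e.
Proof.
have [e eP] := transversal_col F (fun _ : 'I_#|mxidx m n| => k).
exists (residue_card F ^ (\sum_(i < #|mxidx m n|) k))%N, (mxfam_of_col (m := m) (n := n) \o e).
apply: (transversal_transfer (psi := @col_of_mxfam R F I m n) _ _ _ _ _ eP).
- by move=> v v1; apply/integral_col => i; rewrite mxfam_of_colK; exact: v1.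
- by move=> f /integral_col.
- exact: col_of_mxfamB.
- exact: mxfam_of_colK.
- move=> f; split=> [h i|h u].
    by have := h (enum_val i); rewrite !mxE mxentry0 subr0.
  by have := h (enum_rank u); rewrite mxE enum_rankK mxentry0 subr0.
Qed.

End OneFamily.

Section TwoFamilies.
Variables (I J : finType) (m n : I -> nat) (m' n' : J -> nat).
Local Notation V := (mxfam F m n).
Local Notation W := (mxfam F m' n').
Local Notation OV := (@mxfam_integral R F I m n).
Local Notation OW := (@mxfam_integral R F J m' n').

Lemma open_mxfam2 (A : set (V * W)) :
  (forall f, A f -> exists k, forall g, mxcong k f.1 g.1 -> mxcong k f.2 g.2 -> A g) ->
  open A.
Proof.
move=> h; rewrite openE => f /h[k kA].
exists (mxcong k f.1, mxcong k f.2) => /=.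
  by split; apply: open_nbhs_nbhs; split; do ?[exact: open_mxcong|exact: mxcong_refl].
by move=> g [g1 g2]; exact: kA.
Qed.

(** Lets an index in one factor be used inside the product space, where [dxdy] is invariant, while
    the other factor S is carried along. *)
Lemma transversal_prod_l (L H : set V) (S : set W) N (e : 'I_N -> V) :
  S 0 -> transversal L H e -> transversal (L `*` S) (H `*` S) (fun t => (e t, 0) : V * W).
Proof.
move=> S0 [eL eH]; split=> [t|[x y] [/= /eH[t [xt tu]] Sy]]; first by split=> /=.
exists t; split; first by split=> //=; rewrite subr0.
by move=> t' [/= /tu].
Qed.

Lemma transversal_prod_r (L H : set W) (S : set V) N (e : 'I_N -> W) :
  S 0 -> transversal L H e -> transversal (S `*` L) (S `*` H) (fun t => (0, e t) : V * W).
Proof.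
move=> S0 [eL eH]; split=> [t|[x y] [/= Sx /eH[t [yt tu]]]]; first by split=> /=.
exists t; split; first by split=> //=; rewrite subr0.
by move=> t' [/= _ /tu].
Qed.

Variable dx : {measure set (borel V) -> \bar R}.
Variable dxdy : {measure set (borel (V * W)%type) -> \bar R}.
Hypothesis haar_dx : normalized_haar OV dx.
Hypothesis haar_dxdy : normalized_haar (OV `*` OW) dxdy.

Let dxdyD n0 (B : 'I_n0 -> set (V * W)) : (forall i, <<s open >> (B i)) ->
  trivIset setT B -> dxdy (\bigcup_i B i) = (\sum_i dxdy (B i))%E.
Proof. exact: measure_borel_ord. Qed.

Let dxdy_transversal := haar_transversal dxdyD haar_dxdy.

Variables (N : nat) (A : V -> 'M[F]_(N, #|mxidx m' n'|)).
Hypothesis A_integral : forall x, OV x -> integral_mx (A x).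
Hypothesis A_cong : forall k x x', mxcong k x x' ->
  forall i j, labs ((A x' - A x) i j) <= p ^+ k.

Definition fiber (k : nat) (x : V) : set W :=
  [set y | OW y /\ forall i, labs ((A x *m col_of_mxfam y) i 0) <= p ^+ k].

(** The matrix [A x' - A x] sends integral columns to columns of norm at most [p ^+ k], so the
    condition on y is unaffected. *)
Lemma fiber_cong k x x' : mxcong k x x' -> fiber k x `<=` fiber k x'.
Proof.
move=> xx' y [Oy h]; split=> // i.
rewrite -(subrK (A x) (A x')) mulmxDl mxE; apply: labsD_le => //.
rewrite -[leRHS]mulr1; apply: labs_mulmx_le; rewrite ?pX_ge0 ?ler01 //.
  exact: A_cong.
by move=> l j; rewrite ord1; apply/integral_col: l.
Qed.

Lemma fiber_congE k x x' : mxcong k x x' -> fiber k x = fiber k x'.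
Proof. by move=> h; apply/seteqP; split; apply: fiber_cong => //; exact: mxcong_sym. Qed.

Lemma fiber_stable k x y y' : OV x -> mxcong k y y' -> fiber k x y -> fiber k x y'.
Proof.
move=> Ox yy' [Oy h]; split=> [|i]; first exact: mxcong_integral yy' Oy.
rewrite -(subrK (col_of_mxfam y) (col_of_mxfam y')) mulmxDr mxE; apply: labsD_le => //.
rewrite -[leRHS]mul1r; apply: labs_mulmx_le; rewrite ?pX_ge0 ?ler01 //.
  exact: A_integral.
by move=> l j; rewrite ord1 !mxE; exact: yy'.
Qed.

Lemma fiber0 k x : fiber k x 0.
Proof.
split=> [|i]; first exact: mxfam_integral0.
have -> : col_of_mxfam (0 : W) = 0 by apply/colP => l; rewrite !mxE mxentry0.
by rewrite mulmx0 mxE labs0 pX_ge0.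
Qed.

(* The Haar measure of a set S of points y, read off from dxdy as that of OV x S. *)
Definition fiber_measure (k : nat) (x : V) : R := fine (dxdy (OV `*` fiber k x)).

Lemma open_prod_fiber (S : set V) k x l v : OV x ->
  (forall f g, mxcong l f g -> S f -> S g) ->
  open [set f : V * W | (S `*` fiber k x) (f - v)].
Proof.
move=> Ox Sl; apply: open_mxfam2 => f [/= Sf Kf]; exists (maxn k l) => g fg1 fg2.
have le (I' : finType) (a b : I' -> nat) (u w : mxfam F a b) c : (c <= maxn k l)%N ->
    mxcong (maxn k l) u w -> forall t, mxcong c (u - t) (w - t).
  move=> ck h t; move=> i; rewrite !mxentryB opprB addrA subrK.
  by apply: le_trans (h i) _; rewrite ler_pX.
split=> /=; first by apply: Sl Sf; apply: le fg1 _; exact: leq_maxr.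
by apply: fiber_stable Kf => //; apply: le fg2 _; exact: leq_maxl.
Qed.


Definition fiber_level (k : nat) : set (V * W) :=
  [set f | OV f.1 /\ fiber k f.1 f.2].

Lemma mxball_closed k (v f g : V) : mxcong k f g -> mxball k (f - v) -> mxball k (g - v).
Proof.
move=> fg /mxballB fv; apply/mxballB => u.
rewrite -(subrK (mxentry f u) (mxentry g u)) -addrA; exact: labsD_le.
Qed.

Lemma open_mxball k (v : V) : open [set x : V | mxball k (x - v)].
Proof.
rewrite (_ : [set x | _] = mxcong k v); first exact: open_mxcong.
by apply/seteqP; split=> x /mxballB.
Qed.

Lemma haar_mxball k N' (e : 'I_N' -> V) : transversal OV (mxball k) e ->
  (N'%:R%:E * dx (mxball k) = 1)%E.
Proof.
move=> eP; rewrite -haar_dx.2; apply/esym.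
apply: (haar_transversal (measure_borel_ord dx) haar_dx eP); last exact: open_mxball.
move=> t x /mxballB h; apply: mxcong_integral h _; exact: eP.1.
Qed.

Lemma haar_mxball_translate k (v : V) : dx [set x | mxball k (x - v)] = dx (mxball k).
Proof.
apply: (haar_translate haar_dx); apply: sub_sigma_algebra.
by rewrite -[mxball k]translate0; exact: open_mxball.
Qed.

(** The substitute for a product measure: O x fiber is N' translates of ball x fiber for [dxdy], and
    O is N' translates of the ball for [dx], with the same N'. *)
Lemma haar_mxball_fiber k (x v : V) : OV x ->
  dxdy ([set x | mxball k (x - v)] `*` fiber k x) = (dx (mxball k) * dxdy (OV `*` fiber k x))%E.
Proof.
move=> Ox; have [N' [e eP]] := transversal_mxball m n k.
have op w : open [set f : V * W | (mxball k `*` fiber k x) (f - w)].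
  by apply: (@open_prod_fiber _ _ _ k) => // f g; exact: mxball_stable.
have -> : [set x | mxball k (x - v)] `*` fiber k x =
    [set f : V * W | (mxball k `*` fiber k x) (f - (v, 0))].
  by apply/seteqP; split=> -[f g] [/= h1 h2]; split=> //=; move: h2; rewrite subr0.
rewrite (haar_translate haar_dxdy); last first.
  by apply: sub_sigma_algebra; have := op 0; rewrite translate0.
have -> : dxdy (OV `*` fiber k x) = (N'%:R%:E * dxdy (mxball k `*` fiber k x))%E.
  apply: (dxdy_transversal (transversal_prod_l (fiber0 k x) eP) _ op).
  move=> t [f g] [/= h1 h2]; split=> /=; last by rewrite -(subr0 g).
  by move/mxballB: h1 => h1; apply: mxcong_integral h1 _; exact: eP.1.
by rewrite muleA [(dx _ * _)%E]muleC (haar_mxball eP) mul1e.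
Qed.

Lemma measurable_mxball k (v : V) :
  measurable ([set x | mxball k (x - v)] : set (borel V)).
Proof. by apply: sub_sigma_algebra; exact: open_mxball. Qed.

Lemma measurable_OV : measurable (OV : set (borel V)).
Proof.
apply: sub_sigma_algebra; apply: open_mxfam => f Of; exists 0 => g fg.
exact: mxcong_integral fg Of.
Qed.

Lemma measurable_OVOW : measurable (OV `*` OW : set (borel (V * W)%type)).
Proof.
apply: sub_sigma_algebra; apply: open_mxfam2 => f [/= f1 f2]; exists 0 => g h1 h2.
by split; [exact: mxcong_integral h1 f1|exact: mxcong_integral h2 f2].
Qed.

Lemma open_fiber_level k : open (fiber_level k).
Proof.
apply: open_mxfam2 => f [Of Kf]; exists k => g h1 h2; split.
  exact: mxcong_integral h1 Of.
by rewrite -(fiber_congE h1); exact: fiber_stable Of h2 Kf.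
Qed.

Lemma fiber_measure_fin k x : OV x ->
  dxdy (OV `*` fiber k x) = (fiber_measure k x)%:E /\
  0 <= fiber_measure k x <= 1.
Proof.
move=> Ox; have le1 : (dxdy (OV `*` fiber k x) <= 1)%E.
  rewrite -haar_dxdy.2; apply: le_measure; rewrite ?inE.
  - apply: sub_sigma_algebra; have := @open_prod_fiber OV k x 0 0 Ox.
    by rewrite translate0; apply=> f g; exact: mxcong_integral.
  - exact: measurable_OVOW.
  - by move=> [f g] [/= h [h' _]].
have fin : dxdy (OV `*` fiber k x) \is a fin_num.
  by rewrite ge0_fin_numE //; apply: le_lt_trans le1 _; rewrite ltry.
rewrite /fiber_measure fineK //; split=> //.
by rewrite fine_ge0 //= -lee_fin fineK.
Qed.

(** As fibers are constant on classes modulo [w ^+ k], this is a step function; its measurability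
    and integral reduce to indicators of balls. *)
Lemma fiber_measure_simple k : exists N' (e : 'I_N' -> V), transversal OV (mxball k) e /\
  forall x, OV x -> fiber_measure k x =
    \sum_(t < N') fiber_measure k (e t) * \1_[set x | mxball k (x - e t)] x.
Proof.
have [N' [e eP]] := transversal_mxball m n k; exists N', e; split=> // x Ox.
have [t [xt tu]] := eP.2 x Ox.
rewrite (bigD1 t) //= big1 => [|t' t't].
  rewrite indicE mem_set // mulr1 addr0 /fiber_measure (@fiber_congE k (e t) x) //.
  exact/mxballB.
by rewrite indicE memNset ?mulr0 // => /tu e'; rewrite e' eqxx in t't.
Qed.

Lemma measurable_fiber_measure k : measurable_fun (OV : set (borel V)) (fiber_measure k).
Proof.
have [N' [e [_ h]]] := fiber_measure_simple k.
apply: (@eq_measurable_fun _ _ (borel V) R OV (fun x => \sum_(t < N')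
    fiber_measure k (e t) * \1_[set x | mxball k (x - e t)] x)).
  by move=> x; rewrite inE => /h.
apply: measurable_sum => t; apply: measurable_funM => //.
exact: measurable_indic (measurable_mxball k (e t)).
Qed.

Lemma integral_fiber_measure k :
  (\int[dx]_(x in OV) (fiber_measure k x)%:E = dxdy (fiber_level k))%E.
Proof.
have [N' [e [eP h]]] := fiber_measure_simple k.
have eO t : OV (e t) by exact: eP.1.
transitivity (\int[dx]_(x in OV) (\sum_(t < N')
    (fiber_measure k (e t))%:E * (\1_[set x | mxball k (x - e t)] x)%:E))%E.
  apply: eq_integral => x; rewrite inE => /h ->.
  by rewrite -sumEFin; apply: eq_bigr => t _; rewrite EFinM.
rewrite ge0_integral_sum //; last 3 first.
- exact: measurable_OV.
- move=> t; apply/measurable_EFinP; apply: measurable_funM => //.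
  exact: measurable_indic (measurable_mxball k (e t)).
- move=> t x _; rewrite lee_fin mulr_ge0 ?indicE //.
  by have [_ /andP[]] := fiber_measure_fin k (eO t).
(* Over the class of [e t] the fiber is the constant [fiber k (e t)], so the level set is a finite
   disjoint union of products. *)
have -> : fiber_level k = \bigcup_t ([set x | mxball k (x - e t)] `*` fiber k (e t)).
  apply/seteqP; split=> [[x y] [/= Ox Kx]|[x y] [t _ [/= xt Kt]]].
    have [t [xt _]] := eP.2 x Ox; exists t => //; split=> //=.
    by rewrite (@fiber_congE k (e t) x) //; exact/mxballB.
  move/mxballB : xt => xt; split; first exact: mxcong_integral xt (eO t).
  by rewrite /= -(fiber_congE xt).
rewrite dxdyD; last 2 first.
- move=> t; apply: sub_sigma_algebra.
  have := @open_prod_fiber [set x | mxball k (x - e t)] k (e t) k 0 (eO t).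
  by rewrite translate0; apply=> f g; exact: mxball_closed.
- apply/trivIsetP => i j _ _ /eqP ij; apply/seteqP; split=> // -[x y] [[/= xi Ki] [/= xj Kj]].
  have Ox : OV x by move/mxballB : xi => xi; exact: mxcong_integral xi (eO i).
  by have [t [_ u]] := eP.2 x Ox; apply: ij; rewrite (u _ xi) (u _ xj).
apply: eq_bigr => t _; rewrite haar_mxball_fiber //.
have [-> /andP[f0 _]] := fiber_measure_fin k (eO t).
rewrite ge0_integralZl_EFin //; last 2 first.
- exact: measurable_OV.
- apply/measurable_EFinP; exact: measurable_indic (measurable_mxball k (e t)).
rewrite integral_indic; [|exact: measurable_OV|exact: measurable_mxball].
rewrite muleC setIidl ?haar_mxball_translate // => x /mxballB h'.
exact: mxcong_integral h' (eO t).
Qed.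


(** In the coordinates z = [U' y] the fiber is a box, given by |dd j| |z_j| <= p^k and integrality,
    whose index is a power of q read off from its sides. *)
Lemma fiber_measure_smith k x (dd : nat -> F) (a : nat -> nat) (r : nat) : OV x ->
  integral_equiv (A x) (diag_rect N #|mxidx m' n'| dd) ->
  (r <= minn N #|mxidx m' n'|)%N ->
  (forall j, (j < r)%N -> labs (dd j) = p ^+ a j) ->
  (forall j, (r <= j)%N -> dd j = 0) ->
  fiber_measure k x = p ^+ (\sum_(j < r) (k - a j)).
Proof.
move=> Ox [L [L' [U [U' [[iL iL' iU iU'] LL' UU' DE]]]]] rNM ddr dd0.
move: rNM; rewrite leq_min => /andP[rN rM].
(* Truncated subtraction covers a j >= k, where integrality of z_j suffices; from r on [dd] vanishes
   and imposes no condition. *)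
pose kk (j : 'I_#|mxidx m' n'|) := if (j < r)%N then (k - a j)%N else 0%N.
have [e eP] := transversal_col F kk.
have fiberE y : fiber k x y <-> forall j, labs ((U' *m col_of_mxfam y) j 0) <= p ^+ kk j.
  set zy := U' *m col_of_mxfam y.
  have yz : col_of_mxfam y = U *m zy by rewrite mulmxA UU' mul1mx.
  have AD : A x = L' *m diag_rect N #|mxidx m' n'| dd *m U'.
    by rewrite DE !mulmxA (mulmx1C LL') mul1mx -mulmxA UU' mulmx1.
  (* The sum has at most one term, and none when the row index i exceeds all column indices. *)
  have Dz i : (diag_rect N #|mxidx m' n'| dd *m zy) i 0 =
      \sum_(j : 'I_#|mxidx m' n'| | i == j :> nat) dd i * zy j 0.
    by rewrite mxE [RHS]big_mkcond; apply: eq_bigr => j _; rewrite mxE; case: eqP; rewrite ?mul0r.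
  split=> [[Oy h] j|h].
    have z1 : labs (zy j 0) <= 1.
      rewrite -[1]mulr1; apply: labs_mulmx_le; rewrite ?ler01 // => l l'.
      by rewrite ord1; apply/integral_col: l.
    rewrite /kk; case: ifP => // jr.
    have [ka|/ltnW ka] := leqP k (a j); first by rewrite (eqP ka) expr0.
    pose i : 'I_N := Ordinal (leq_trans jr rN).
    have : labs ((L *m (A x *m col_of_mxfam y)) i 0) <= p ^+ k.
      rewrite -[leRHS]mul1r; apply: labs_mulmx_le; rewrite ?ler01 ?pX_ge0 // => l l'.
      by rewrite ord1.
    rewrite yz mulmxA mulmxA -DE Dz (big_pred1 j) => [|l]; last by rewrite eq_sym.
    rewrite labsM ddr //= -(subnKC ka) exprD ler_pM2l ?pX_gt0 //.
    by rewrite subnKC.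
  have z1 j : labs (zy j 0) <= 1 by apply: le_trans (h j) (pX_le1 _ _).
  split.
    apply/integral_col => i; rewrite yz -[1]mulr1; apply: labs_mulmx_le; rewrite ?ler01 // => l l'.
    by rewrite ord1.
  move=> i; rewrite AD -!mulmxA -/zy -[leRHS]mul1r.
  apply: labs_mulmx_le; rewrite ?ler01 ?pX_ge0 // => l l'; rewrite ord1 Dz.
  apply: labs_sum_le => [|j /eqP lj]; first exact: pX_ge0.
  have [lr|rl] := ltnP l r; last by rewrite dd0 // mul0r labs0 pX_ge0.
  rewrite labsM ddr //; have := h j; rewrite /kk -lj lr => hj.
  apply: (@le_trans _ _ (p ^+ a l * p ^+ (k - a l))); first by rewrite ler_pM2l ?pX_gt0.
  by rewrite -exprD ler_pX -leq_subLR.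
have tr : transversal OW (fiber k x) ((mxfam_of_col (m := m') (n := n') \o mulmx U) \o e).
  apply: (transversal_transfer (psi := mulmx U' \o @col_of_mxfam R F J m' n') _ _ _ _ _ eP).
  - move=> v v1; apply/integral_col => i; rewrite mxfam_of_colK -[1]mulr1.
    by apply: labs_mulmx_le; rewrite ?ler01 // => l l'; rewrite ord1; exact: v1.
  - move=> y /integral_col y1 i; rewrite -[1]mulr1.
    by apply: labs_mulmx_le; rewrite ?ler01 // => l l'; rewrite ord1.
  - by move=> y y'; rewrite /= col_of_mxfamB mulmxBr.
  - by move=> v; rewrite /= mxfam_of_colK mulmxA (mulmx1C UU') mul1mx.
  - exact: fiberE.
have fib1 t y : fiber k x (y - (((mxfam_of_col (m := m') (n := n') \o mulmx U) \o e) t)) -> OW y.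
  move=> [h _]; have := mxfam_integralD h (tr.1 t); by rewrite subrK.
have sumE : (\sum_j kk j = \sum_(j < r) (k - a j))%N.
  rewrite (big_ord_widen _ (fun j => (k - a j)%N) rM) [RHS]big_mkcond.
  by apply: eq_bigr => j _; rewrite /kk.
have oF v : open [set f : V * W | (OV `*` fiber k x) (f - v)].
  exact: (@open_prod_fiber OV k x 0 v Ox (fun f g => @mxcong_integral I m n 0 f g)).
have h : dxdy (OV `*` OW) =
    ((residue_card F ^ (\sum_j kk j))%:R%:E * dxdy (OV `*` fiber k x))%E.
  apply: (dxdy_transversal (transversal_prod_r (@mxfam_integral0 I m n) tr) _ oF).
  move=> t [f g] [/= h1 h2].
  by split=> /=; [rewrite -(subr0 f)|exact: fib1 h2].
move: h; rewrite haar_dxdy.2 (fiber_measure_fin k Ox).1 sumE.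
rewrite -EFinM natrX => -[] h.
have q0 : q ^+ (\sum_(j < r) (k - a j)) != 0 by rewrite expf_neq0 // gt_eqF ?q_gt0.
by rewrite exprVn; apply: (mulfI q0); rewrite -h mulfV.
Qed.

End TwoFamilies.
End IntegralPoints.
(** * Zero sets of polynomial functions *)

Section Determinants.
Variables (R : realType) (F : localFieldType R).

Lemma labs_prodB_le (J : Type) (s : seq J) (f g : J -> F) (t : R) : 0 <= t ->
  (forall j, labs (f j) <= 1) -> (forall j, labs (g j) <= 1) ->
  (forall j, labs (f j - g j) <= t) ->
  labs (\prod_(j <- s) f j - \prod_(j <- s) g j) <= t.
Proof.
move=> t0 f1 g1 fg; elim: s => [|j s IH]; first by rewrite !big_nil subrr labs0.
rewrite !big_cons; apply: labs_mulB_le => //.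
rewrite labs_prod; apply: prodr_ile1 => i _; rewrite labs_ge0 /=; exact: g1.
Qed.

(** On integral matrices the determinant is Lipschitz with constant 1, so minors inherit congruences
    between matrices. *)
Lemma labs_detB_le n (A B : 'M[F]_n) (t : R) : 0 <= t ->
  integral_mx A -> integral_mx B -> (forall i j, labs (A i j - B i j) <= t) ->
  labs (\det A - \det B) <= t.
Proof.
move=> t0 iA iB AB; rewrite /determinant -sumrB; apply: labs_sum_le => // s _.
by rewrite -mulrBr labsM labs_sign mul1r; apply: labs_prodB_le.
Qed.

Lemma det_line_poly n (A B : 'M[F]_n) : exists pi : {poly F},
  (size pi <= n.+1)%N /\ forall t, \det (A + t *: B) = pi.[t].
Proof.
pose M : 'M[{poly F}]_n := \matrix_(i, j) ((A i j)%:P + (B i j) *: 'X).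
exists (\det M); split=> [|t].
  apply: (leq_trans (size_sum _ _ _)); apply/bigmax_leqP => s _.
  rewrite mulr_sign; have -> (P : {poly F}) (b : bool) : size (if b then - P else P) = size P.
    by case: b; rewrite ?size_polyN.
  apply: leq_trans (size_poly_prod_leq _ _) _.
  rewrite card_ord leq_subLR.
  (* Each of the n factors has size at most 2, and a product of n polynomials has size at most the
     sum of sizes plus 1 minus n, here 2n + 1 - n. *)
  apply: (@leq_trans (\sum_(i < n) 2).+1).
    rewrite ltnS; apply: leq_sum => i _; rewrite mxE.
    apply: leq_trans (size_polyD _ _) _; rewrite geq_max.
    rewrite (leq_trans (size_polyC_leq1 _)) //=.
    by apply: leq_trans (size_scale_leq _ _) _; rewrite size_polyX.
  by rewrite sum_nat_const card_ord addnS muln2 addnn.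
rewrite -horner_evalE -det_map_mx; congr (\det _); apply/matrixP => i j.
by rewrite !mxE /= /horner_eval hornerD hornerC hornerZ hornerX mulrC.
Qed.

End Determinants.

Section NullSets.
Variables (R : realType) (F : localFieldType R).
Hypothesis charF0 : [pchar F] =i pred0.
Variables (I : finType) (m n : I -> nat).
Local Notation V := (mxfam F m n).
Local Notation O := (@mxfam_integral R F I m n).
Local Notation p := ((residue_card F)%:R^-1 : R).
Variable dx : {measure set (borel V) -> \bar R}.
Hypothesis haar_dx : normalized_haar O dx.

Variables (P : V -> F) (deg : nat) (x0 : V).
Hypothesis P_line : forall x v : V, exists pi : {poly F},
  (size pi <= deg)%N /\ forall t, P (x + mxscale t v) = pi.[t].
Hypothesis P_cong : forall k x x', O x -> O x' -> mxcong k x x' ->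
  labs (P x' - P x) <= p ^+ k.
Hypotheses (O_x0 : O x0) (P_x0 : P x0 != 0).

Definition span (s : seq (mxidx m n)) : set V :=
  [set w | O w /\ forall u, u \notin s -> mxentry w u = 0].

(** Interpolates between the zero set of P, for s empty, and the empty set, for s listing all
    coordinates; freeing one more coordinate removes only a null set. *)
Definition flat_zeros (s : seq (mxidx m n)) : set V :=
  [set x | O x /\ forall w, span s w -> P (x + w) = 0].

Lemma labs_natr k : labs (k%:R : F) <= 1.
Proof.
elim: k => [|k IH]; first by rewrite labs0 ler01.
by rewrite -addn1 natrD; apply: labsD_le => //; rewrite labs1.
Qed.

Lemma natr_inj_char0 : injective (fun k => k%:R : F).
Proof.
move=> i j; wlog ij : i j / (i <= j)%N => [h|/eqP].
  by case: (leqP i j) => [|/ltnW] ij e; [exact: h|exact/esym/h].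
rewrite eq_sym -subr_eq0 -natrB // (pcharf0P _).1 // subn_eq0 => ji.
by apply/eqP; rewrite eqn_leq ij.
Qed.

(** The complement inside O is open: if |P| > p^k at some displaced point, P stays non-zero there
    when x moves within its class modulo [w ^+ k]. *)
Lemma measurable_flat_zeros s (c : V) : O c ->
  measurable ([set x | flat_zeros s (x + c)] : set (borel V)).
Proof.
move=> Oc; pose E := [set x : V | O x /\ exists w, span s w /\ P (x + c + w) != 0].
have Oadd x : O (x + c) <-> O x.
  split=> [h|h]; last exact: mxfam_integralD.
  by rewrite -(addrK c x); apply: mxfam_integralD => //; exact: mxfam_integralN.
have -> : [set x | flat_zeros s (x + c)] = O `\` E.
  apply/seteqP; split=> x /=.
    move=> [/Oadd Ox h]; split=> // -[_ [w [sw /eqP]]]; apply; exact: h.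
  move=> [Ox nE]; split; first exact/Oadd.
  move=> w sw; apply: contrapT => /eqP Pw; apply: nE; split=> //.
  by exists w.
apply: measurableD; first exact: measurable_OV.
apply: sub_sigma_algebra; apply: open_mxfam => x [Ox [w [sw Pw]]].
have := Pw; rewrite -labs_gt0 => /(pX_small F)[k hk].
exists k => x' xx'; have Ox' := mxcong_integral xx' Ox.
split=> //; exists w; split=> //; apply: contraTneq hk => Pw'.
rewrite -leNgt; have := @P_cong k (x + c + w) (x' + c + w).
rewrite Pw' sub0r labsN; apply.
- by apply: mxfam_integralD sw.1; exact: mxfam_integralD.
- by apply: mxfam_integralD sw.1; exact: mxfam_integralD.
- by move=> u; have := xx' u; rewrite !mxentryD opprD addrACA subrr addr0 opprD addrACA subrr addr0.
Qed.

(* If x lies in some translate of S := flat_zeros s \ flat_zeros (u :: s) by a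
   multiple of the basis vector v in direction u, then P is a non-zero polynomial
   along some line x + w' + t v, and each t such that x + t v is in S is a root.
   So x is in at most deg of the translates of S by the j v, which all have the
   same measure. *)
Lemma flat_zeros_step s u : dx (flat_zeros s `\` flat_zeros (u :: s)) = 0%E.
Proof.
pose v : V := mxfam_delta F u.
pose S := flat_zeros s `\` flat_zeros (u :: s).
pose c (j : nat) : V := mxscale j%:R v.
have Oc j : O (c j).
  move=> a; rewrite mxentryZ mxentry_delta labsM -[leRHS]mulr1.
  by apply: ler_pM; rewrite ?labs_ge0 ?labs_natr ?labs_bool.
pose T j := [set x | S (x + c j)].
have mT j : measurable (T j : set (borel V)).
  exact: measurableD (measurable_flat_zeros s (Oc j)) (measurable_flat_zeros (u :: s) (Oc j)).
have mS : <<s open >> S.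
  have O0 := @mxfam_integral0 R F I m n.
  have := measurableD (measurable_flat_zeros s O0) (measurable_flat_zeros (u :: s) O0).
  by congr measurable; apply/seteqP; split=> x /=; rewrite addr0.
have dT j : dx (T j) = dx S.
  rewrite -(haar_translate haar_dx (- c j) mS); congr (dx _).
  by apply/seteqP; split=> x; rewrite /T /= opprK.
have TO j : T j `<=` O.
  move=> x [[h _] _]; rewrite -(addrK (c j) x).
  by apply: mxfam_integralD => //; exact: mxfam_integralN.
have count x N : \sum_(j < N) \1_(T j) x <= deg%:R :> R.
  have [[i [Si nSi]]|nT] := pselect (exists i : 'I_N, T i x); last first.
    rewrite big1 ?ler0n // => j _; rewrite indicE memNset // => Tj.
    by apply: nT; exists j.
  have [w [[Ow sw] Pw]] : exists w, span (u :: s) w /\ P (x + c i + w) != 0.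
    apply: contrapT => h; apply: nSi; split=> [|w sw]; first exact: Si.1.
    by apply: contrapT => /eqP Pw; apply: h; exists w.
  (* Without its component along v, the displacement lies in [span s]; that component is absorbed
     into the parameter of the line. *)
  pose w' := w - mxscale (mxentry w u) v.
  have sw' : span s w'.
    split=> [|a sa].
      apply: mxfam_integralD => //; apply: mxfam_integralN => a.
      rewrite mxentryZ mxentry_delta labsM -[leRHS]mulr1.
      by apply: ler_pM; rewrite ?labs_ge0 ?labs_bool //; exact: Ow.
    rewrite mxentryB mxentryZ mxentry_delta; have [->|au] := eqVneq a u.
      by rewrite mulr1 subrr.
    by rewrite mulr0 subr0 sw // inE negb_or au.
  have [pi [pi_size piE]] := P_line (x + w') v.
  have pi0 : pi != 0.
    (* The parameter i + w_u gives back the point [x + c i + w], where P does not vanish. *)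
    apply: contraNneq Pw => pi0; have := piE (i%:R + mxentry w u).
    rewrite pi0 horner0 => <-; apply/eqP; congr P; apply: mxfamP => a.
    by rewrite /w' /c !(mxentryD, mxentryN, mxentryZ); ring.
  pose A : pred 'I_N := [pred j : 'I_N | x \in T j].
  have -> : \sum_(j < N) \1_(T j) x = #|A|%:R :> R.
    rewrite -sum1_card natr_sum [RHS]big_mkcond; apply: eq_bigr => j _.
    by rewrite indicE inE /=; case: (x \in T j).
  rewrite ler_nat; apply: leq_trans pi_size; apply: ltnW.
  pose nr (j : 'I_N) : F := (nat_of_ord j)%:R.
  have -> : #|A| = size (map nr (enum A)) by rewrite size_map cardE.
  apply: max_poly_roots => //.
    apply/allP => _ /mapP[j jA ->].
    have [Sj _] : T j x by move: jA; rewrite mem_enum => jA; exact: set_mem jA.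
    apply/rootP; rewrite -piE; have := Sj.2 w' sw'; congr (P _ = _).
    by apply: mxfamP => a; rewrite /c !(mxentryD, mxentryZ); ring.
  rewrite map_inj_uniq ?enum_uniq // => j k /natr_inj_char0; exact: val_inj.
have le N : (N%:R%:E * dx S <= deg%:R%:E)%E.
  have -> : (N%:R%:E * dx S = \int[dx]_(x in O) \sum_(j < N) (\1_(T j) x)%:E)%E.
    rewrite ge0_integral_sum; last 3 first.
    - exact: measurable_OV.
    - by move=> j; apply/measurable_EFinP; exact: measurable_indic (mT j).
    - by move=> j x _; rewrite lee_fin indicE.
    rewrite (eq_bigr (fun=> dx S)); first by rewrite sumr_const card_ord mule_natl.
    move=> j _; rewrite integral_indic; [|exact: measurable_OV|exact: mT].
    by rewrite setIidl ?dT.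
  apply: (@le_trans _ _ (\int[dx]_(x in O) (cst deg%:R%:E) x)%E); last first.
    by rewrite integral_cst ?haar_dx.2 ?mule1 //; exact: measurable_OV.
  apply: ge0_le_integral.
  - exact: measurable_OV.
  - by move=> x _; apply: sume_ge0 => j _; rewrite lee_fin indicE.
  - apply: emeasurable_sum => j; apply/measurable_EFinP; exact: measurable_indic (mT j).
  - exact: measurable_cst.
  - by move=> x _; rewrite sumEFin lee_fin.
have fin : dx S \is a fin_num.
  by rewrite ge0_fin_numE //; have := le 1; rewrite mul1e => /le_lt_trans; apply; rewrite ltry.
move: le; rewrite -/S -(fineK fin) => le; congr _%:E.
apply/eqP; rewrite eq_le fine_ge0 ?measure_ge0 // andbT leNgt; apply/negP => d0.
(* If S had positive measure, some N would exceed deg / dx S, against the bound. *)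
have := le (Num.bound (deg%:R / fine (dx S))).
rewrite -EFinM lee_fin leNgt => /negP; apply.
by rewrite -ltr_pdivrMr // archi_boundP // divr_ge0 // ltW.
Qed.

Lemma measurable_flat_zeros0 s : measurable (flat_zeros s : set (borel V)).
Proof.
have := measurable_flat_zeros s (@mxfam_integral0 R F I m n).
by congr measurable; apply/seteqP; split=> x /=; rewrite addr0.
Qed.

Lemma flat_zeros_null s' s : dx (flat_zeros (s' ++ s)) = 0%E -> dx (flat_zeros s) = 0%E.
Proof.
elim: s' s => // u s' IH s h.
have {}h : dx (flat_zeros (u :: s)) = 0%E.
  apply: (IH (u :: s)); rewrite -h; congr (dx _).
  have e a : (a \in s' ++ u :: s) = (a \in (u :: s') ++ s).
    by rewrite /= !(inE, mem_cat); case: (a == u); case: (a \in s'); rewrite ?orbT.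
  apply/seteqP; split=> x [Ox hx]; split=> // w [Ow sw]; apply: hx; split=> // a;
    by move=> ha; apply: sw; rewrite ?e // -e.
apply/eqP; rewrite eq_le measure_ge0 andbT.
have sub : flat_zeros s `<=` (flat_zeros s `\` flat_zeros (u :: s)) `|` flat_zeros (u :: s).
  by move=> x fx; case: (pselect (flat_zeros (u :: s) x)) => hx; [right|left].
have m1 := measurableD (measurable_flat_zeros0 s) (measurable_flat_zeros0 (u :: s)).
have m2 := measurable_flat_zeros0 (u :: s).
apply: le_trans (le_measure dx _ _ sub) _; rewrite ?inE.
- exact: measurable_flat_zeros0.
- exact: measurableU.
have := measureU2 dx m1 m2.
by rewrite [X in (_ <= X + _)%E]flat_zeros_step [X in (_ <= _ + X)%E]h adde0.
Qed.

Lemma zeros_null : dx.-negligible [set x | O x /\ P x = 0].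
Proof.
(* With every coordinate free, x0 - x is an admissible displacement, and P does not vanish at x0. *)
have E0 : flat_zeros (enum {: mxidx m n} ++ [::]) = set0.
  apply/seteqP; split=> // x [Ox h]; move: P_x0; rewrite -(h (x0 - x)).
    by rewrite addrC subrK eqxx.
  split=> [|u]; first by apply: mxfam_integralD => //; exact: mxfam_integralN.
  by rewrite mem_cat mem_enum.
have null : dx (flat_zeros [::]) = 0%E.
  by apply: (@flat_zeros_null (enum {: mxidx m n})); rewrite E0 measure0.
exists (flat_zeros [::]); split=> //; first exact: measurable_flat_zeros0.
move=> x [Ox Px]; split=> // w [_ h].
have -> : w = 0 by apply: mxfamP => u; rewrite h // mxentry0.
by rewrite addr0.
Qed.

End NullSets.
(** * The zeta function of the moment map *)

Section Measurability.
Variable R : realType.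

Lemma measurable_fun_open (T : ptopologicalType) (D : set T) (f : T -> R) :
  open D -> (forall c, open (D `&` [set x | c < f x])) ->
  measurable_fun (D : set (borel T)) (f : borel T -> R).
Proof.
move=> oD oc mD; apply: (measurability _ (RGenOInfty.measurableE R)) => //.
move=> _ [_ [c ->] <-]; apply: sub_sigma_algebra.
have := oc c; congr open; apply/seteqP; split=> x [Dx /=]; by rewrite in_itv /= andbT.
Qed.

Lemma measurable_Re_cpow (z : R[i]) : measurable_fun setT (fun t : R => complex.Re (cpow t z)).
Proof.
have -> : (fun t : R => complex.Re (cpow t z)) =
    fun t => t `^ complex.Re z * cos (complex.Im z * ln t).
  by apply/funext => t; rewrite Re_mulc /= mul0r subr0.
apply: measurable_funM; first exact: measurable_powR.
apply: (measurableT_comp (continuous_measurable_fun (@continuous_cos R))).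
by apply: measurable_funM => //; exact: measurable_ln.
Qed.

Lemma measurable_Im_cpow (z : R[i]) : measurable_fun setT (fun t : R => complex.Im (cpow t z)).
Proof.
have -> : (fun t : R => complex.Im (cpow t z)) =
    fun t => t `^ complex.Re z * sin (complex.Im z * ln t).
  by apply/funext => t; rewrite Im_mulc /= mul0r addr0.
apply: measurable_funM; first exact: measurable_powR.
apply: (measurableT_comp (continuous_measurable_fun (@continuous_sin R))).
by apply: measurable_funM => //; exact: measurable_ln.
Qed.

Context (disp : measure_display) (T : measurableType disp) (D : set T).
Hypothesis mD : measurable D.
Implicit Types f g h : T -> R.

Lemma measurable_fun_ge0V f : (forall x, 0 <= f x) -> measurable_fun D f ->
  measurable_fun D (fun x => (f x)^-1).
Proof.
(* The inverse and the power of exponent -1 agree at 0 too, where both are 0. *)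
move=> f0 mf; have -> : (fun x => (f x)^-1) = (fun t => t `^ (-1)) \o f.
  by apply/funext => x; rewrite /= powR_inv1.
by apply: measurableT_comp => //; exact: measurable_powR.
Qed.

Lemma measurable_zeta_integrand (s : R[i]) (Dl : int -> T -> R) (i : nat) :
  (forall j x, 0 <= Dl j x) -> (forall j, measurable_fun D (Dl j)) ->
  measurable_fun D (fun x => complex.Re (zeta_integrand s (Dl ^~ x) i)) /\
  measurable_fun D (fun x => complex.Im (zeta_integrand s (Dl ^~ x) i)).
Proof.
move=> D0 mDl; have mV j := measurable_fun_ge0V (D0 j) (mDl j).
have mq j k : measurable_fun D (fun x => Dl j x / Dl k x) by exact: measurable_funM.
pose z := s + i%:R.
have E x : zeta_integrand s (Dl ^~ x) i =
   (cpow (Dl i x / Dl (i%:Z - 1) x) z - cpow (Dl (i%:Z + 1) x / Dl i x) z) * ((Dl i x)^-1)%:C.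
  by rewrite /zeta_integrand -(fmorphV (real_complex R)).
have ReE (u v : R[i]) t : complex.Re ((u - v) * t%:C) = (complex.Re u - complex.Re v) * t.
  by rewrite Re_mulc Re_addc Re_oppc /= mulr0 subr0.
have ImE (u v : R[i]) t : complex.Im ((u - v) * t%:C) = (complex.Im u - complex.Im v) * t.
  by rewrite Im_mulc Im_addc Im_oppc /= mulr0 add0r.
split.
  under eq_fun do rewrite E ReE.
  apply: measurable_funM => //; apply: measurable_funB.
    exact: (measurableT_comp (measurable_Re_cpow z) (mq i (i%:Z - 1))).
  exact: (measurableT_comp (measurable_Re_cpow z) (mq (i%:Z + 1) i)).
under eq_fun do rewrite E ImE.
apply: measurable_funM => //; apply: measurable_funB.
  exact: (measurableT_comp (measurable_Im_cpow z) (mq i (i%:Z - 1))).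
exact: (measurableT_comp (measurable_Im_cpow z) (mq (i%:Z + 1) i)).
Qed.

End Measurability.

Section LevelNorm.
Variables (R : realType) (F : localFieldType R).
Local Notation p := ((residue_card F)%:R^-1 : R).

Lemma level_vnorm (J : finType) (v : J -> F) : (forall j, labs (v j) <= 1) ->
  level F (vnorm v).
Proof.
move=> v1; rewrite /vnorm; elim/big_ind: _ => [|a b la lb|j _]; first by left.
  by rewrite /Num.max; case: ifP.
have [->|vj] := eqVneq (v j) 0; first by left; rewrite labs0.
by right; exact: labs_level.
Qed.

(** If p^k < ||g x||, a perturbation of size at most p^k cannot lower the norm, since ||g x|| <=
    max(||g y||, p^k). *)
Lemma open_vnorm (T : topologicalType) (D : set T) (J : finType) (g : T -> J -> F) :
  open D -> (forall x k, D x -> exists U, [/\ open U, U x &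
    forall y, D y -> U y -> forall j, labs (g x j - g y j) <= p ^+ k]) ->
  forall c : R, open (D `&` [set x | c < vnorm (g x)]).
Proof.
move=> oD gU c; rewrite openE => x [Dx /= cx].
(* For c < 0 the norm at x may be 0, with no power of p below it; but then all of D qualifies. *)
have [c0|c0] := ltP c 0.
  have : nbhs x D by exact: open_nbhs_nbhs.
  by apply: filterS => y Dy; split=> //=; apply: lt_le_trans c0 (vnorm_ge0 _).
have [k hk] := pX_small F (le_lt_trans c0 cx).
have [U [oU Ux gUx]] := gU x k Dx.
have : nbhs x (D `&` U) by apply: open_nbhs_nbhs; split=> //; exact: openI.
apply: filterS => y [Dy Uy]; split=> //=; apply: lt_le_trans cx _.
have := vnorm_diff_le (gUx y Dy Uy); rewrite le_max => /orP[//|].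
by rewrite leNgt hk.
Qed.

End LevelNorm.

(** * Comparison of the two integrals for the moment map *)

Section MomentZeta.
Variables (R : realType) (F : localFieldType R) (Q : quiver) (d : vertex Q -> nat).
Hypothesis charF0 : [pchar F] =i pred0.
Local Notation q := ((residue_card F)%:R : R).
Local Notation p := (q^-1).
Local Notation M := #|mxidx (fun a : arrow Q => d (src a)) (fun a => d (tgt a))|.
Local Notation V := (rep F d).
Local Notation W := (corep F d).
Local Notation OV := (rep_integral F d).
Local Notation OW := (corep_integral F d).
Local Notation A := (@moment_mx R F Q d).
Local Notation r := (moment_rank F d).
Local Notation Dl := (fun x i => minors_norm r (A x) i).
Variable dx : {measure set (borel V) -> \bar R}.
Variable dxdy : {measure set (borel (V * W)%type) -> \bar R}.
Hypothesis haar_dx : normalized_haar OV dx.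
Hypothesis haar_dxdy : normalized_haar (OV `*` OW) dxdy.
Variable s : R[i].
Hypothesis Re_s_gt0 : 0 < complex.Re s.

Let mOV : measurable (OV : set (borel V)).
Proof. exact: measurable_OV. Qed.

Let mOVOW : measurable (OV `*` OW : set (borel (V * W)%type)).
Proof. exact: measurable_OVOW. Qed.

Lemma moment_mx_integral (x : V) : OV x -> integral_mx (A x).
Proof. by move=> Ox; apply: labs_moment_mx_le; rewrite ?ler01. Qed.

Lemma moment_mx_cong k (x x' : V) : mxcong k x x' ->
  forall i j, labs ((A x' - A x) i j) <= p ^+ k.
Proof.
move=> h i j; rewrite -moment_mxB; apply: labs_moment_mx_le; first exact: pX_ge0.
by move=> u; rewrite mxentryB.
Qed.

Lemma moment_rank_ge (x : V) : OV x -> (\rank (A x) <= r)%N.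
Proof.
move=> Ox; have rk : (\rank (A x) < M.+1)%N.
  by rewrite ltnS rank_leq_col.
rewrite /moment_rank (bigD1 (Ordinal rk)) /=; first exact: leq_maxl.
by apply/asboolP; exists x.
Qed.

Lemma moment_rank_attained : exists x : V, OV x /\ \rank (A x) = r.
Proof.
have O0 : OV 0 by exact: mxfam_integral0.
have rk : (\rank (A (0%R : V)) < M.+1)%N.
  by rewrite ltnS rank_leq_col.
pose C := [pred k : 'I_M.+1 |
  `[< exists2 x, OV x & \rank (A x) = k >]].
have C0 : (0 < #|C|)%N.
  by apply/card_gt0P; exists (Ordinal rk); apply/asboolP; exists (0%R : V).
have [k kC rE] := eq_bigmax_cond (fun k => nat_of_ord k) C0.
move: kC => /asboolP[x Ox xk]; exists x; split=> //.
by rewrite xk -rE; apply: eq_bigl => j; rewrite inE.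
Qed.

(** The rank of [A x] is at most r, so [dd r = 0] and the convention that the norm of index r + 1 is
    0 agrees with the product formula. *)
Lemma moment_smith (x : V) : OV x -> exists dd : nat -> F,
  [/\ integral_equiv (A x) (diag_rect _ _ dd),
      forall j, labs (dd j) <= 1,
      forall j, labs (dd j.+1) <= labs (dd j),
      dd r = 0 /\ (forall j, (dd j != 0) = (j < \rank (A x))%N)
    & forall i : nat, (i <= r.+1)%N -> Dl x i = \prod_(j < i) labs (dd j)].
Proof.
move=> Ox; have [dd [eqv mono dd0]] := smith_normal_form (A x).
have ddS i : dd i = 0 -> dd i.+1 = 0.
  move=> e; apply/labs_eq0/eqP; rewrite eq_le labs_ge0 andbT.
  by have := mono i; rewrite e labs0.
have rkE j : (dd j != 0) = (j < \rank (A x))%N.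
  by rewrite (mxrank_equiv eqv) mxrank_diag_rect.
have ddr : dd r = 0.
  by apply/eqP; rewrite -[_ == _]negbK rkE -leqNgt moment_rank_ge.
have dd00 : labs (dd 0) <= 1.
  have [h|/dd0->] := ltnP 0 (minn #|mxidx d d| M); last first.
    by rewrite labs0 ler01.
  move: h; rewrite leq_min => /andP[h1 h2].
  have -> : dd 0 = diag_rect #|mxidx d d| M dd
      (Ordinal h1) (Ordinal h2) by rewrite mxE.
  exact: (integral_equiv_le eqv (moment_mx_integral Ox)).
exists dd; split=> // [j|i ir].
  by elim: j => // j; apply: le_trans.
rewrite /minors_norm; case: i ir => [|i] ir; first by rewrite /= big_ord0.
rewrite /= eqz_nat eqSS; have [->|_] := eqVneq i r.
  by rewrite big_ord_recr /= ddr labs0 mulr0.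
rewrite (vnorm_minors_equiv _ eqv) vnorm_minors_diag //.
Qed.

Lemma minors_norm_ge0 (x : V) i : 0 <= Dl x i.
Proof. by rewrite /minors_norm; case: ifP => // _; case: ifP => // _; exact: vnorm_ge0. Qed.

Lemma minors_norm_m1 (x : V) : Dl x (-1) = 1.
Proof. by []. Qed.

Lemma normc_moment_integrand (x : V) i : OV x -> (i <= r)%N ->
  Normc.normc (zeta_integrand s (Dl x) i) <= 2.
Proof.
move=> Ox ir; have [dd [_ dd1 mono _ DlE]] := moment_smith Ox.
exact: (normc_zeta_integrand Re_s_gt0 (fun j => labs_ge0 (dd j)) dd1 mono DlE
  (minors_norm_m1 x) ir).
Qed.


Lemma minors_norm_rank (x : V) : (0 < r)%N -> Dl x r = vnorm (@minors R F _ _ (A x) r).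
Proof. by move=> r0; rewrite /minors_norm lez_nat leqn0 gtn_eqF //= eqz_nat ltn_eqF. Qed.

Lemma ae_moment_rank : {ae dx, forall x, OV x -> \rank (A x) = r}.
Proof.
(* For r = 0, [minors_norm] at r is the convention 1 rather than a norm of minors; the rank is then
   constantly 0. *)
have [r0|r0] := posnP r.
  apply: aeW => x Ox; apply/eqP; rewrite eqn_leq moment_rank_ge //.
  by rewrite {1}r0.
have [x0 [Ox0 x0r]] := moment_rank_attained.
have [dd [eqv _ _ [_ rkE] DlE]] := moment_smith Ox0.
have [fg fgP] : exists fg, @minors R F _ _ (A x0) r fg != 0.
  apply: contrapT => h; have : vnorm (@minors R F _ _ (A x0) r) <= 0.
    apply/vnorm_le => // fg; rewrite le_eqVlt; apply/orP; left; apply/eqP/labs_eq0.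
    by apply: contrapT => /eqP h'; apply: h; exists fg.
  rewrite -minors_norm_rank // DlE // leNgt => /negP; apply; apply: prodr_gt0 => j _.
  by rewrite labs_gt0 rkE x0r.
pose P (x : V) : F := minors (A x) fg.
have P_line (x v : V) : exists pi : {poly F},
    (size pi <= r.+1)%N /\ forall t, P (x + mxscale t v) = pi.[t].
  have [pi [pis piE]] := det_line_poly (mxsub (val fg.1) (val fg.2) (A x))
    (mxsub (val fg.1) (val fg.2) (A v)).
  exists pi; split=> // t; rewrite -piE /P /minors moment_mx_linear.
  by congr (\det _); apply/matrixP => i j; rewrite !mxE.
have P_cong k (x x' : V) : OV x -> OV x' -> mxcong k x x' -> labs (P x' - P x) <= p ^+ k.
  move=> Ox Ox' xx'; apply: labs_detB_le; first exact: pX_ge0.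
  - by move=> i j; rewrite mxE; exact: moment_mx_integral.
  - by move=> i j; rewrite mxE; exact: moment_mx_integral.
  - move=> i j; rewrite [X in labs (X - _)]mxE [X in labs (_ - X)]mxE.
    have := moment_mx_cong xx' (val fg.1 i) (val fg.2 j).
    by rewrite [X in labs X]mxE [X in labs (_ + X)]mxE.
apply: negligibleS (zeros_null charF0 haar_dx P_line P_cong Ox0 fgP).
move=> x /= /not_implyP[Ox rx]; split=> //; apply: contrapT => /eqP Px; apply: rx.
(* Where P is non-zero, so is the norm of index r, hence each of the first r divisors; that of index
   r - 1 shows that the rank is at least r. *)
have [dd' [_ _ _ [_ rkE'] DlE']] := moment_smith Ox.
apply/eqP; rewrite eqn_leq moment_rank_ge //= -[X in (X <= _)%N](prednK r0) -rkE'.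
have : Dl x r != 0.
  rewrite minors_norm_rank // gt_eqF //.
  by apply: lt_le_trans (le_vnorm (@minors R F _ _ (A x) r) fg); rewrite labs_gt0.
rewrite DlE' // => /prodf_neq0 h; have rr : (r.-1 < r)%N by rewrite prednK.
by have := h (Ordinal rr) isT; rewrite labs_neq0.
Qed.

Local Notation z := (cpow q (- s)).
Local Notation e := (fun n => 2 / (1 - q `^ (- complex.Re s)) * (q `^ (- complex.Re s)) ^+ n).

Lemma moment_generic (x : V) : OV x -> \rank (A x) = r ->
  (forall i : nat, (i <= r)%N -> Dl x i != 0) /\
  forall n, Normc.normc ((1 - \sum_(i < r.+1) cpow q (- i%:R) * (1 - z) /
      (1 - cpow q (- (s + i%:R))) * zeta_integrand s (Dl x) i) -
    (1 - \sum_(k < n) (1 - z) * z ^+ k * (fiber_measure dxdy A k.+1 x)%:C)) <= e n.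
Proof.
move=> Ox rx; have [dd [eqv dd1 mono [ddr rkE] DlE]] := moment_smith Ox.
split=> [i ir|n].
  rewrite DlE ?leqW //; apply/prodf_neq0 => j _; rewrite labs_neq0 rkE rx.
  exact: leq_trans (ltn_ord j) ir.
(* Only divisors of index below r are powers of p in absolute value; later exponents are a
   default. *)
have /choice[a aP] j : exists k, (j < r)%N -> labs (dd j) = p ^+ k.
  have [jr|_] := ltnP j r; last by exists 0.
  have [|k kE] := labs_level (dd1 j); first by rewrite rkE rx.
  by exists k.
have ddge j : (r <= j)%N -> dd j = 0.
  by move=> rj; apply/eqP; rewrite -[_ == _]negbK rkE rx -leqNgt.
have rmin : (r <= minn #|mxidx d d| M)%N.
  by rewrite -rx leq_min rank_leq_row rank_leq_col.
under [X in _ - (1 - X)]eq_bigr do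
  rewrite (fiber_measure_smith haar_dxdy moment_mx_integral _ Ox eqv rmin aP ddge).
have lr : labs (dd r) = 0 by rewrite ddr labs0.
exact: (zeta_fiber_approx Re_s_gt0 mono lr DlE (minors_norm_m1 x) aP).
Qed.

Lemma measurable_minors_norm (i : int) :
  measurable_fun (OV : set (borel V)) (fun x : borel V => Dl x i).
Proof.
have [i0|i0] := boolP (i <= 0).
  have -> : (fun x : borel V => minors_norm r (A (x : V)) i) = cst 1.
    by apply/funext => x; rewrite /minors_norm i0.
  exact: measurable_cst.
have [ir|ir] := boolP (i == r.+1%:Z).
  have -> : (fun x : borel V => minors_norm r (A (x : V)) i) = cst 0.
    by apply/funext => x; rewrite /minors_norm (negbTE i0) ir.
  exact: measurable_cst.
have -> : (fun x : borel V => minors_norm r (A (x : V)) i) =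
    fun x : borel V => vnorm (@minors R F _ _ (A (x : V)) `|i|%N).
  by apply/funext => x; rewrite /minors_norm (negbTE i0) (negbTE ir).
have oO : open OV.
  by apply: open_mxfam => f Of; exists 0 => g fg; exact: mxcong_integral fg Of.
apply: measurable_fun_open => //; apply: open_vnorm => // x k Ox.
exists (mxcong k x); split; [exact: open_mxcong|exact: mxcong_refl|].
move=> y Oy xy fg; apply: labs_detB_le; first exact: pX_ge0.
- by move=> a b; rewrite mxE; exact: moment_mx_integral.
- by move=> a b; rewrite mxE; exact: moment_mx_integral.
- move=> a b; rewrite [X in labs (X - _)]mxE [X in labs (_ - X)]mxE.
  have := moment_mx_cong (mxcong_sym xy) (val fg.1 a) (val fg.2 b).
  by rewrite [X in labs X]mxE [X in labs (_ + X)]mxE.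
Qed.

Lemma cintegrable_moment_integrand i : (i <= r)%N ->
  cintegrable dx OV (fun x => zeta_integrand s (Dl x) i).
Proof.
move=> ir; have [m1 m2] := @measurable_zeta_integrand R _ (borel V) OV s (fun j x => Dl x j) i
  (fun j x => minors_norm_ge0 x j) measurable_minors_norm.
split.
  apply: (integrable_bounded mOV haar_dx.2 (M := 2) m1).
  by move=> x Ox; apply: le_trans (Re_le_normc _) (normc_moment_integrand Ox ir).
apply: (integrable_bounded mOV haar_dx.2 (M := 2) m2).
by move=> x Ox; apply: le_trans (Im_le_normc _) (normc_moment_integrand Ox ir).
Qed.


Lemma vnorm_moment_le (x : V) (y : W) k :
  (vnorm (mxentry (moment x y)) <= p ^+ k) =
  `[< forall i, labs ((A x *m col_of_mxfam y) i 0) <= p ^+ k >].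
Proof.
apply/(vnorm_le _ (pX_ge0 F k))/asboolP => h i; first by rewrite -col_moment mxE.
by have := h (enum_rank i); rewrite -col_moment mxE enum_rankK.
Qed.

Lemma labs_moment (x : V) (y : W) : OV x -> OW y ->
  forall u, labs (mxentry (moment x y) u) <= 1.
Proof.
move=> Ox Oy; apply/integral_col => i; rewrite col_moment -[leRHS]mulr1.
apply: labs_mulmx_le; rewrite ?ler01 //; first exact: moment_mx_integral.
by move=> l j; rewrite ord1; apply/integral_col: l.
Qed.

Local Notation normmu := (fun xy : V * W => vnorm (mxentry (moment xy.1 xy.2))).

Lemma vnorm_moment_level (xy : V * W) : (OV `*` OW) xy -> level F (normmu xy).
Proof. by move=> [Ox Oy]; apply: level_vnorm; exact: labs_moment. Qed.

Lemma vnorm_moment_le1 (xy : V * W) : (OV `*` OW) xy -> normmu xy <= 1.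
Proof. by move=> [Ox Oy]; apply/vnorm_le => //; exact: labs_moment. Qed.

Lemma open_OVOW : open (OV `*` OW).
Proof.
apply: open_mxfam2 => f [/= f1 f2]; exists 0 => g h1 h2.
by split; [exact: mxcong_integral h1 f1|exact: mxcong_integral h2 f2].
Qed.

Lemma measurable_vnorm_moment :
  measurable_fun (OV `*` OW : set (borel (V * W)%type)) (normmu : borel (V * W)%type -> R).
Proof.
apply: (@measurable_fun_open R (V * W)%type); first exact: open_OVOW.
apply: open_vnorm; first exact: open_OVOW.
move=> [x y] k [Ox Oy]; exists (mxcong k x `*` mxcong k y); split.
- apply: open_mxfam2 => f [/= f1 f2]; exists k => g g1 g2.
  by split; [exact: mxcong_trans f1 g1|exact: mxcong_trans f2 g2].
- by split; exact: mxcong_refl.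
- move=> [x' y'] [/= Ox' Oy'] [/= xx' yy'] u.
  have E (a : V) (b : W) : mxentry (moment a b) u = (A a *m col_of_mxfam b) (enum_rank u) 0.
    by rewrite -col_moment mxE enum_rankK.
  have -> : mxentry (moment x y) u - mxentry (moment x' y') u =
      (A x *m (col_of_mxfam y - col_of_mxfam y') + (A x - A x') *m col_of_mxfam y') (enum_rank u) 0.
    by rewrite !E mulmxBr mulmxBl addrA subrK !mxE.
  rewrite mxE; apply: labsD_le.
    rewrite -[leRHS]mul1r; apply: labs_mulmx_le; rewrite ?pX_ge0 ?ler01 //.
      exact: moment_mx_integral.
    by move=> l j; rewrite ord1 !mxE labs_distC; exact: yy'.
  rewrite -[leRHS]mulr1; apply: labs_mulmx_le; rewrite ?pX_ge0 ?ler01 //.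
    exact: moment_mx_cong (mxcong_sym xx').
  by move=> l j; rewrite ord1; apply/integral_col: l.
Qed.

Lemma cintegrable_moment : cintegrable dxdy (OV `*` OW) (fun xy => cpow (normmu xy) s).
Proof.
have le1 xy : (OV `*` OW) xy -> Normc.normc (cpow (normmu xy) s) <= 1.
  move=> Oxy; rewrite normc_cpow.
  have <- : (1 : R) `^ complex.Re s = 1 by rewrite powR1.
  apply: ge0_ler_powR; rewrite ?nnegrE ?vnorm_ge0 ?ler01 //; first exact: ltW.
  exact: vnorm_moment_le1.
have mre : measurable_fun (OV `*` OW : set (borel (V * W)%type))
    (fun xy => complex.Re (cpow (normmu xy) s)).
  exact: (measurableT_comp (measurable_Re_cpow s) measurable_vnorm_moment).
have mim : measurable_fun (OV `*` OW : set (borel (V * W)%type))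
    (fun xy => complex.Im (cpow (normmu xy) s)).
  exact: (measurableT_comp (measurable_Im_cpow s) measurable_vnorm_moment).
split.
  apply: (integrable_bounded mOVOW haar_dxdy.2 (M := 1) mre).
  by move=> xy Oxy; apply: le_trans (Re_le_normc _) (le1 xy Oxy).
apply: (integrable_bounded mOVOW haar_dxdy.2 (M := 1) mim).
by move=> xy Oxy; apply: le_trans (Im_le_normc _) (le1 xy Oxy).
Qed.

Lemma cintegrable_real (D : measure_display) (T : measurableType D)
    (mu : {measure set T -> \bar R}) (S : set T) (g : T -> R) :
  measurable S -> mu S = 1%E -> measurable_fun S g -> (forall x, S x -> `|g x| <= 1) ->
  cintegrable mu S (fun x => (g x)%:C).
Proof.
move=> mS mu1 mg g1; split; first exact: (integrable_bounded mS mu1 (M := 1) mg).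
have m0 : measurable_fun S (cst 0 : T -> R) by exact: measurable_cst.
by apply: (integrable_bounded mS mu1 (M := 0) m0) => x _; rewrite normr0.
Qed.

Local Notation Pk := (fun k => fine (dxdy (fiber_level A k))).

(** The indicators of the level sets integrate to the numbers [Pk], to which the fiber measures
    integrate as well: here the two measures meet. *)
Lemma moment_approx_level n :
  exists g : nat -> V * W -> R[i],
  [/\ forall k, cintegrable dxdy (OV `*` OW) (g k),
      forall k, cintegral dxdy (OV `*` OW) (g k) = (Pk k.+1)%:C
    & forall xy, (OV `*` OW) xy -> Normc.normc (cpow (normmu xy) s -
        (1 - \sum_(k < n) (1 - z) * z ^+ k * g k xy)) <= e n].
Proof.
have mL k : measurable (fiber_level A k : set (borel (V * W)%type)).
  apply: sub_sigma_algebra.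
  exact: (@open_fiber_level R F _ _ _ _ _ _ _ A moment_mx_integral moment_mx_cong k).
exists (fun k xy => (\1_(fiber_level A k.+1) xy)%:C); split=> [k|k|xy Oxy].
- apply: (cintegrable_real mOVOW haar_dxdy.2); first exact: measurable_indic (mL k.+1).
  by move=> xy _; rewrite indicE; case: (_ \in _); rewrite ?normr1 ?normr0.
- rewrite cintegral_real; last exact: mOVOW.
  rewrite /Rintegral integral_indic; [|exact: mOVOW|exact: mL].
  rewrite setIidl // => -[x y] [Ox [Oy _]]; split=> //.
- rewrite (eq_bigr (fun k : 'I_n => (1 - z) * z ^+ k * (normmu xy <= p ^+ k.+1)%R%:R)).
    have h := @cpow_level_approx R F s Re_s_gt0 _ n (vnorm_moment_level Oxy).
    exact: h.
  move=> k _; congr (_ * _); rewrite vnorm_moment_le indicE.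
  have [Ox Oy] := Oxy; case: asboolP => h.
    by rewrite mem_set.
  by rewrite memNset // => -[_ [_ h']].
Qed.

Lemma moment_approx_fiber :
  (forall k, cintegrable dx OV (fun x => (fiber_measure dxdy A k x)%:C)) /\
  (forall k, cintegral dx OV (fun x => (fiber_measure dxdy A k x)%:C) = (Pk k)%:C).
Proof.
split=> k.
  apply: (cintegrable_real mOV haar_dx.2).
    exact: measurable_fiber_measure moment_mx_cong k.
  move=> x Ox; have [_ /andP[h0 h1]] := fiber_measure_fin haar_dxdy moment_mx_integral k Ox.
  by rewrite ger0_norm.
rewrite cintegral_real; last exact: mOV.
by rewrite /Rintegral (integral_fiber_measure haar_dx haar_dxdy moment_mx_integral moment_mx_cong).
Qed.

Lemma moment_zeta_formula :
  cintegral dxdy (OV `*` OW) (fun xy => cpow (normmu xy) s) =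
  1 - \sum_(i < r.+1) cpow q (- i%:R) * (1 - z) / (1 - cpow q (- (s + i%:R)))
        * cintegral dx OV (fun x => zeta_integrand s (Dl x) i).
Proof.
have r0 := rho_gt0 F s; have r1 := rho_lt1 F Re_s_gt0.
have e_ge0 n : 0 <= e n.
  by rewrite mulr_ge0 ?exprn_ge0 ?powR_ge0 // divr_ge0 // subr_ge0 ltW.
pose c (i : nat) := cpow q (- i%:R) * (1 - z) / (1 - cpow q (- (s + i%:R))).
have [hi hE] := cintegral_affine mOV haar_dx.2 c
  (fun i (ir : (i < r.+1)%N) => cintegrable_moment_integrand (i := i) ir).
rewrite -hE; have [fi fE] := moment_approx_fiber.
apply: (@complex_eq_approx R _ _ (fun n => 1 - \sum_(k < n) (1 - z) * z ^+ k * (Pk k.+1)%:C) e).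
- move=> eps eps0; have c0 : 0 < 2 / (1 - q `^ (- complex.Re s)) by rewrite divr_gt0 // subr_gt0.
  have [N NP] := expr_small (ltW r0) r1 (divr_gt0 eps0 c0).
  by exists N; rewrite mulrC -ltr_pdivlMr // NP.
- move=> n; have [g [gi gE gP]] := moment_approx_level n.
  have [wi wE] := cintegral_affine mOVOW haar_dxdy.2 (n := n)
    (fun k => (1 - z) * z ^+ k) (fun k (_ : (k < n)%N) => gi k).
  have -> : 1 - \sum_(k < n) (1 - z) * z ^+ k * (Pk k.+1)%:C =
     1 - \sum_(k < n) (1 - z) * z ^+ k * cintegral dxdy (OV `*` OW) (g k).
    by congr (_ - _); apply: eq_bigr => k _; rewrite gE.
  rewrite -wE; apply: (cintegral_close mOVOW haar_dxdy.2) => //.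
  - exact: cintegrable_moment.
  - by apply: aeW => xy; exact: gP.
- move=> n; have [wi wE] := cintegral_affine mOV haar_dx.2 (n := n)
    (fun k => (1 - z) * z ^+ k) (fun k (_ : (k < n)%N) => fi k.+1).
  have -> : 1 - \sum_(k < n) (1 - z) * z ^+ k * (Pk k.+1)%:C =
     1 - \sum_(k < n) (1 - z) * z ^+ k *
       cintegral dx OV (fun x => (fiber_measure dxdy A k.+1 x)%:C).
    by congr (_ - _); apply: eq_bigr => k _; rewrite fE.
  rewrite -wE; apply: (cintegral_close mOV haar_dx.2) => //.
  (* The pointwise comparison on the fibers is available at points of rank r, that is, almost
     everywhere. *)
  - apply: (@filterS _ _ (ae_filter_ringOfSetsType dx) _ _ _ ae_moment_rank) => x rx Ox.
    exact: (moment_generic Ox (rx Ox)).2.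
Qed.

End MomentZeta.
Theorem proposition4 (R : realType) (F : localFieldType R)
    (charF0 : [pchar F] =i pred0)
    (Q : quiver) (d : vertex Q -> nat)
    (dx : {measure set (borel (rep F d)) -> \bar R})
    (dxdy : {measure set (borel (rep F d * corep F d)%type) -> \bar R})
    (haar_dx : normalized_haar (rep_integral F d) dx)
    (haar_dxdy :
       normalized_haar (rep_integral F d `*` corep_integral F d) dxdy)
    (s : R[i]) (Re_s_gt0 : 0 < complex.Re s) :
  let O := rep_integral F d in
  let OO := rep_integral F d `*` corep_integral F d in
  let q : R := (residue_card F)%:R in
  let r := moment_rank F d in
  let mu (xy : rep F d * corep F d) := mxentry (moment xy.1 xy.2) in
  let Delta (i : int) (x : rep F d) := minors_norm r (moment_mx x) i in
  let integrand (i : nat) (x : rep F d) : R[i] :=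
    (cpow (Delta i x / Delta (i%:Z - 1) x) (s + i%:R)
     - cpow (Delta (i%:Z + 1) x / Delta i x) (s + i%:R))
    / (Delta i x)%:C in
  [/\ cintegrable dxdy OO (fun xy => cpow (vnorm (mu xy)) s),
      (forall i : nat, (i <= r)%N ->
         {ae dx, forall x, O x -> Delta i x != 0} /\
         cintegrable dx O (integrand i))
    & igusa_zeta dxdy OO mu s =
      1 - \sum_(i < r.+1)
            cpow q (- i%:R) * (1 - cpow q (- s)) / (1 - cpow q (- (s + i%:R)))
            * cintegral dx O (integrand i)].
Proof.
move=> O OO q r mu Delta integrand; split.
- exact: cintegrable_moment haar_dxdy _ Re_s_gt0.
- move=> i ir; split; last exact: cintegrable_moment_integrand haar_dx _ Re_s_gt0 _ ir.
  have ae_rank := ae_moment_rank charF0 haar_dx.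
  apply: (@filterS _ _ (ae_filter_ringOfSetsType dx) _ _ _ ae_rank) => x rx Ox.
  by have [nz _] := moment_generic haar_dxdy Re_s_gt0 Ox (rx Ox); exact: nz.
- exact: (moment_zeta_formula charF0 haar_dx haar_dxdy Re_s_gt0).
Qed.
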